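(* For every integer $k\ge 4$, every uncompletable word for $S_k$ has length at least $5k^2-17k+13$. Consequently (together with the existence of an uncompletable word of that length), the length of a minimal uncompletable word for $S_k$ equals $5k^2-17k+13$.
   Context: $\Sigma=\{a,b\}$. $S_k=\left(\Sigma^k\setminus\{ba^{k-1},b^{k-1}a\}\right)\cup\left(\Sigma^{k-1}\setminus\{a^{k-1},b^{k-1}\}\right)$. $\mathit{Fact}(S^* )$ is the set of all factors of words in $S^*$. A word $w\in\Sigma^*\setminus\mathit{Fact}(S_k^* )$ is called uncompletable for $S_k$; a minimal uncompletable word is an uncompletable word of minimal length. *)

(* Defs.v *)
From HB Require Import structures.
From mathcomp Require Import all_boot.
Set Implicit Arguments. Unset Strict Implicit. Unset Printing Implicit Defensive.

Inductive letter := La | Lb.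
Definition letter_eqb (x y : letter) : bool :=
  match x, y with La, La | Lb, Lb => true | _, _ => false end.
Lemma letter_eqP : Equality.axiom letter_eqb.
Proof. by case; case; constructor. Qed.
HB.instance Definition _ := hasDecEq.Build letter letter_eqP.

Definition word := seq letter.

Definition S (k : nat) (w : word) : bool :=
  ((size w == k) && (w != Lb :: nseq k.-1 La) && (w != rcons (nseq k.-1 Lb) La))
  || ((size w == k.-1) && (w != nseq k.-1 La) && (w != nseq k.-1 Lb)).

Definition in_star (X : word -> bool) (u : word) : Prop :=
  exists ss : seq word, all X ss /\ flatten ss = u.

Definition in_fact_star (X : word -> bool) (w : word) : Prop :=
  exists u p q : word, in_star X u /\ u = p ++ w ++ q.

Definition uncompletable (k : nat) (w : word) : Prop := ~ in_fact_star (S k) w.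

(* Main.v *)
Require Import Defs.
From mathcomp Require Import all_boot zify.

(** Read a word from left to right and call a position dead if it cannot be
    reached from one of the first [k] positions by steps along factors in [S k].
    Only the last [k] positions matter, and they behave as a cyclic register of
    [k] cells: the letter read at time [t] overwrites cell [t mod k], using only
    its old value and the next cell, by one of four operations.  It keeps the
    cell inside a long run, kills it when [b a^(k-1)] has just been read, copies
    the next cell after [b^(k-1) a], and takes the conjunction of the two in all
    other cases.  A word is uncompletable iff it makes all [k] cells dead.

    Each long run sweeps [k - 2] consecutive cells with conjunctions, which
    shortens every block of dead cells except at most one.  So the number [m] of
    cyclically adjacent dead pairs essentially grows only when a copy fills a gap
    of one cell between an isolated dead cell and the main block.  The bound is a
    potential argument: the time needed to reach a given register is at least
    [(5 k - 4) m] plus a correction that depends on the letter of the last long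
    run and, if the dead cells form a single block, on its position.  The
    word [b a^k (prod_(1 <= i <= k-3) b^(k-1) a^(k+i) b^(2k-3-i) a^k) b^(k-1) a]
    attains the bound; each of its rounds costs [5 k - 4] letters and enlarges the
    dead block by one. *)

Set Implicit Arguments. Unset Strict Implicit. Unset Printing Implicit Defensive.

(** * Descents and sums of Boolean sequences *)

Definition desc (p : nat -> bool) (a b : nat) := \sum_(a <= i < b) (p i && ~~ p i.+1).

Lemma desc_cat (p : nat -> bool) a b c : a <= b -> b <= c -> desc p a c = desc p a b + desc p b c.
Proof. by move=> ab bc; rewrite /desc (big_cat_nat (n := b)). Qed.

Lemma desc_ge (p : nat -> bool) a b : a <= b -> p a <= p b + desc p a b.
Proof.
move=> /subnKC <-; elim: (b - a) => [|n IH]; first by rewrite addn0 leq_addr.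
rewrite addnS /desc big_nat_recr ?leq_addr //= -/(desc p a (a + n)).
by move: IH; case: (p a); case: (p (a + n)); case: (p (a + n).+1); lia.
Qed.

(** A true position has a true successor or is a descent, so descents count the blocks that end
    inside the range. *)
Lemma sum_pairs (p : nat -> bool) a b :
  \sum_(a <= i < b) (p i : nat) = \sum_(a <= i < b) (p i && p i.+1) + desc p a b.
Proof.
by rewrite /desc -big_split /=; apply: eq_bigr => i _; case: (p i); case: (p i.+1).
Qed.

Lemma sum_interval a m n : \sum_(0 <= i < n) (a <= i < a + m) <= m.
Proof.
have -> : \sum_(0 <= i < n) (a <= i < a + m) = minn n (a + m) - minn n a.
  elim: n => [|n IH]; first by rewrite big_geq // !min0n.
  by rewrite big_nat_recr //= IH; lia.
by lia.
Qed.

Lemma sum_true (p : nat -> bool) a b :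
  (forall i, a <= i < b -> p i) -> b - a <= \sum_(a <= i < b) (p i : nat).
Proof.
move=> H; have -> : b - a = \sum_(a <= i < b) 1 by rewrite sum_nat_const_nat muln1.
rewrite big_nat_cond [leqRHS]big_nat_cond.
by apply: leq_sum => i; rewrite andbT => /H ->.
Qed.

Lemma sum_last (F : nat -> nat) a b : a < b ->
  \sum_(a <= i < b) F i = \sum_(a <= i < b.-1) F i + F b.-1.
Proof. by case: b => // b ab; rewrite big_nat_recr. Qed.

Lemma sum_shift (F : nat -> nat) a b :
  \sum_(a.+1 <= i < b) F i = \sum_(a <= i < b.-1) F i.+1.
Proof. by rewrite big_add1. Qed.

Lemma eq_sum (F G : nat -> nat) a b :
  (forall i, a <= i < b -> F i = G i) -> \sum_(a <= i < b) F i = \sum_(a <= i < b) G i.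
Proof. exact: eq_big_nat. Qed.

Lemma desc0_sum (p : nat -> bool) a b : a <= b -> desc p a b = 0 -> p a ->
  b - a <= \sum_(a <= i < b) (p i : nat) /\ p b.
Proof.
move=> ab z pa; have H i : a <= i <= b -> p i.
  case/andP=> ai ib; have := desc_ge p ai; move: z.
  by rewrite (desc_cat p ai ib) pa; case: (p i) => //; clear; lia.
split; last by apply: H; rewrite ab leqnn.
by apply: sum_true => i /andP[ai ib]; apply: H; rewrite ai ltnW.
Qed.

(** * Leading runs of reversed words *)

(* Words are stored reversed from here on, so the last run read is in front. *)
Definition lead (l : letter) (r : word) := find (predC1 l) r.
Arguments lead : simpl never.

Lemma take_lead (m : nat) (l : letter) (r : word) : (take m r == nseq m l) = (m <= lead l r).
Proof.
elim: r m => [|x r IH] [|m] //=.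
by rewrite /lead /= eqseq_cons IH; case: eqP.
Qed.

Lemma take_lead_end (m : nat) (l l' : letter) (r : word) : l' != l -> m < size r ->
  (take m.+1 r == rcons (nseq m l) l') = (lead l r == m) && (nth l r m == l').
Proof.
move=> ll; elim: r m => [|x r IH] [|m] //=.
  by move=> _; rewrite take0 eqseq_cons andbT /lead /=; case: (x =P l) => [->|_] //=;
    rewrite ?(negbTE ll) 1?eq_sym ?(negbTE ll).
by move=> mr; rewrite eqseq_cons IH // /lead /=; case: (x =P l).
Qed.

Lemma lead_other (r : word) (l l' : letter) : l' != l -> lead l (l' :: r) = 0.
Proof. by rewrite /lead /= => ->. Qed.

Lemma lead_same (r : word) (l : letter) : lead l (l :: r) = (lead l r).+1.
Proof. by rewrite /lead /= eqxx. Qed.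

Lemma lead_ab (r : word) : lead La r = 0 \/ lead Lb r = 0.
Proof. by case: r => [|[] r]; [left | right | left]; rewrite ?lead_other. Qed.

Lemma cat_nseqS (n : nat) (l : letter) (r : word) : nseq n.+1 l ++ r = l :: (nseq n l ++ r).
Proof. by []. Qed.

Lemma lead_nseq (n : nat) (l : letter) (r : word) : lead l (nseq n l ++ r) = n + lead l r.
Proof. by elim: n => //= n IH; rewrite lead_same IH. Qed.

Lemma lead_nseq_other (n : nat) (l l' : letter) (r : word) :
  l' != l -> 0 < n -> lead l (nseq n l' ++ r) = 0.
Proof. by move=> ll; case: n => //= n _; rewrite lead_other. Qed.

(** * The cyclic register *)

Section Register.
Variables (k : nat) (hk : 4 <= k).
Implicit Types (f g : nat -> bool) (r w : word) (l : letter).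

(* [f i] says that cell [i] is dead, where cell [0] is the next one to be
   overwritten and cell [k - 1] the last one written; values [f i] with [k <= i]
   are junk. *)
Definition push f x i := if i == k.-1 then x else f i.+1.
Definition keep f := push f (f 0).
Definition meet f := push f (f 0 && f 1).
Definition copy f := push f (f 1).
Definition kill f := push f true.

Definition sub f g := forall i, i < k -> f i -> g i.
Definition succk i := if i == k.-1 then 0 else i.+1.
Definition ndead f := \sum_(0 <= i < k) (f i : nat).
Definition pairs f := \sum_(0 <= i < k) (f i && f (succk i)).

Lemma pairsE f :
  pairs f = \sum_(0 <= i < k.-1) (f i && f i.+1) + (f k.-1 && f 0).
Proof.
rewrite /pairs -[in LHS](prednK (n := k)); last by lia.
rewrite big_nat_recr //= /succk eqxx; congr (_ + _).
by apply: eq_big_nat => i /andP[_ hi]; rewrite ltn_eqF.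
Qed.

Lemma ndeadE f : ndead f = \sum_(0 <= i < k.-1) (f i : nat) + f k.-1.
Proof. by rewrite /ndead -[in LHS](prednK (n := k)) ?big_nat_recr //; lia. Qed.

Lemma ndead_desc f : ndead f = pairs f + desc f 0 k.-1 + (f k.-1 && ~~ f 0).
Proof. by rewrite ndeadE pairsE sum_pairs; case: (f k.-1); case: (f 0); lia. Qed.

Lemma succk_lt i : i < k -> succk i < k.
Proof. by rewrite /succk; case: eqP; lia. Qed.

Lemma pairs_sub f g : sub f g -> pairs f <= pairs g.
Proof.
move=> fg; rewrite /pairs big_nat_cond [leqRHS]big_nat_cond.
apply: leq_sum => i /andP[/andP[_ ik] _].
have nk := succk_lt ik.
by case: (boolP (f i)) (fg i ik) => //= _ -> //; case: (boolP (f _)) (fg _ nk) => //= _ ->.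
Qed.

Lemma ndead_sub f g : sub f g -> ndead f <= ndead g.
Proof.
move=> fg; rewrite /ndead big_nat_cond [leqRHS]big_nat_cond.
apply: leq_sum => i /andP[/andP[_ ik] _].
by case: (boolP (f i)) (fg i ik) => //= _ ->.
Qed.

Lemma pairs_le f a m :
  (forall i, i < k -> f i -> f (succk i) -> a <= i < a + m) -> pairs f <= m.
Proof.
move=> H; apply: leq_trans (sum_interval a m k).
rewrite /pairs big_nat_cond [leqRHS]big_nat_cond; apply: leq_sum => i /andP[/andP[_ ik] _].
by case: (boolP (f i)) (H i ik) => //= _; case: (f _) => //= ->.
Qed.

Lemma pairs_keep f : pairs (keep f) = pairs f.
Proof.
have H i : i < k.-1 -> keep f i = f i.+1 by rewrite /keep /push => ?; rewrite ifF //; lia.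
have Hl : keep f k.-1 = f 0 by rewrite /keep /push eqxx.
have e : k.-2.+1 = k.-1 by lia.
rewrite !pairsE sum_last; last by lia.
rewrite [in RHS]big_ltn; last by lia.
rewrite sum_shift e Hl H; last by lia.
rewrite H; last by lia.
rewrite e.
have -> : \sum_(0 <= i < k.-2) (keep f i && keep f i.+1) =
          \sum_(0 <= i < k.-2) (f i.+1 && f i.+2).
  by apply: eq_big_nat => i hi; rewrite !H //; lia.
by rewrite addnC addnA.
Qed.

Lemma ndead_keep f : ndead (keep f) = ndead f.
Proof.
rewrite /ndead -[k](prednK (n := k)); last by lia.
rewrite [LHS]big_nat_recr // [RHS]big_nat_recl //= addnC /keep /push eqxx; congr (_ + _).
by apply: eq_big_nat => i /andP[_ hi]; rewrite ltn_eqF.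
Qed.

(* [ndead f - pairs f] is the number of blocks of dead cells, so the first
   hypothesis says that there is at most one block. *)
Lemma block_at0 f i : ndead f <= (pairs f).+1 -> f 0 -> ~~ f k.-1 ->
  i < k -> f i -> i <= pairs f.
Proof.
move=> b1 f0 fk ik fi; have ik1 : i < k.-1.
  by rewrite ltn_neqAle; apply/andP; split; [apply: contraNneq fk => <- | lia].
(* If the cells up to [i] are all dead, they form [i] pairs. Otherwise a live cell [j] below [i]
   forces one descent before [j] and one after [i], hence two blocks, against [b1]. *)
case: (boolP (all f (iota 0 i))) => [/allP al|].
  have H j : 0 <= j < i.+1 -> f j.
    by rewrite /= ltnS leq_eqVlt => /orP[/eqP->//|ji]; apply: al; rewrite mem_iota.
  rewrite pairsE (big_cat_nat (n := i)) //=; last by lia.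
  rewrite -addnA; apply: leq_trans (leq_addr _ _).
  apply: leq_trans (sum_true (p := fun j => f j && f j.+1) _); first by rewrite subn0.
  by move=> j ji; rewrite !H //; lia.
case/allPn => j; rewrite mem_iota => /andP[_ ji] fj.
move: b1; rewrite ndead_desc f0 (negbTE fk) (@desc_cat f 0 j k.-1) //; last by lia.
have := desc_ge f (a := 0) (b := j) isT.
have ji' : j <= i by apply: ltnW.
have := desc_ge f ji'.
have := desc_ge f (ltnW ik1).
rewrite (@desc_cat f j i k.-1) //; last by apply: ltnW.
rewrite f0 fi (negbTE fj) (negbTE fk) /=.
move: (desc _ _ _) (desc _ _ _) (desc _ _ _) (pairs _) => x y z w.
by lia.
Qed.

(* The cyclic interval of [n] cells that starts at cell [o]. *)
Definition iv o n i := (o <= i < o + n) || (i + k < o + n).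

(** * Monotonicity of the operations and closed forms of their iterates *)

Lemma sub_trans f g h : sub f g -> sub g h -> sub f h.
Proof. by move=> fg gh i ik /(fg i ik) /(gh i ik). Qed.

Lemma sub_refl f : sub f f.
Proof. by []. Qed.

Lemma sub_push f g (x y : bool) : sub f g -> (x -> y) -> sub (push f x) (push g y).
Proof.
by move=> fg xy i ik; rewrite /push; case: eqP => // ne; apply: fg; lia.
Qed.

Lemma sub_keep f g : sub f g -> sub (keep f) (keep g).
Proof. by move=> fg; apply: sub_push => //; apply: fg; lia. Qed.

Lemma sub_meet f g : sub f g -> sub (meet f) (meet g).
Proof.
by move=> fg; apply: sub_push => // /andP[f0 f1]; rewrite !fg //; lia.
Qed.

Lemma sub_meet_keep f g : sub f g -> sub (meet f) (keep g).
Proof. by move=> fg; apply: sub_push => // /andP[f0 _]; apply: fg => //; lia. Qed.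

Lemma sub_kill f g : sub f g -> sub (kill f) (kill g).
Proof. by move=> fg; apply: sub_push. Qed.

Lemma sub_meet_kill f g : sub f g -> sub (meet f) (kill g).
Proof. by move=> fg; apply: sub_push. Qed.

Lemma sub_iter_keep n f g : sub f g -> sub (iter n keep f) (iter n keep g).
Proof. by move=> fg; elim: n => //= n; apply: sub_keep. Qed.

Lemma sub_iter_meet n f g : sub f g -> sub (iter n meet f) (iter n meet g).
Proof. by move=> fg; elim: n => //= n; apply: sub_meet. Qed.

Lemma sub_iter_meet_keep n f g : sub f g -> sub (iter n meet f) (iter n keep g).
Proof. by move=> fg; elim: n => //= n; apply: sub_meet_keep. Qed.

Lemma iter_keepE n f i : n <= k -> i < k ->
  iter n keep f i = f (if i + n < k then i + n else i + n - k).
Proof.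
move=> nk; elim: n nk i => [|n IH] nk i ik; first by rewrite addn0 ik.
rewrite iterS {1}/keep /push; case: eqP => [->|ne].
  rewrite IH; try lia.
  by congr f; do 2 case: ifP; lia.
by rewrite IH ?addSnnS //; lia.
Qed.

(** As [n < k], no conjunction reads a cell that has been overwritten, so all operands are original
    values. *)
Lemma iter_meetE n f i : n < k -> i < k ->
  iter n meet f i = if i + n < k then f (i + n) else f (i + n - k) && f (i + n - k).+1.
Proof.
move=> nk; elim: n nk i => [|n IH] nk i ik; first by rewrite addn0 ik.
rewrite iterS {1}/meet /push; case: eqP => [->|ne]; last by rewrite IH ?addSnnS //; lia.
rewrite !IH; try lia.
rewrite ifT; last by lia.
rewrite ifT; last by lia.
rewrite ifF; last by lia.
by congr (f _ && f _); lia.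
Qed.

(** * Location of a single cyclic block *)

Lemma pairs_iter_keep n f : pairs (iter n keep f) = pairs f.
Proof. by elim: n => //= n <-; rewrite pairs_keep. Qed.

Lemma ndead_iter_keep n f : ndead (iter n keep f) = ndead f.
Proof. by elim: n => //= n <-; rewrite ndead_keep. Qed.

Lemma block_from o f : o < k -> ndead f <= (pairs f).+1 -> f o ->
  ~~ f (if o is o'.+1 then o' else k.-1) -> sub f (iv o (pairs f).+1).
Proof.
move=> ok b1 fo fo' i ik fi; set g := iter o keep f.
have g0 : g 0 by rewrite /g iter_keepE ?add0n ?ok //; lia.
have gk : ~~ g k.-1.
  rewrite /g iter_keepE; [|lia..].
  case: o ok fo' {fo g g0} => [|o] ok fo'; first by rewrite ifT addn0 //; lia.
  by rewrite ifF; [rewrite (_ : _ - k = o) //; lia | lia].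
have H j : j < k -> g j -> j <= pairs f.
  rewrite -[pairs f](pairs_iter_keep o) => jk gj; apply: block_at0 => //.
  by rewrite /g ndead_iter_keep pairs_iter_keep.
rewrite /iv; case: (leqP o i) => oi.
  have : i - o <= pairs f by apply: H; rewrite /g ?iter_keepE ?subnK ?ik //; lia.
  by lia.
have : i + k - o <= pairs f.
  apply: H; first by lia.
  rewrite /g iter_keepE; [|lia..].
  by rewrite subnK ?ifF ?addnK //; lia.
by lia.
Qed.

(** Either some dead cell follows a live one and the block starts there, or liveness spreads from
    cell [i] around the whole cycle. *)
Lemma block_any f : ndead f <= (pairs f).+1 ->
  (exists2 i, i < k & ~~ f i) -> exists2 o, o < k & sub f (iv o (pairs f).+1).
Proof.
move=> b1 [i ik fi].
case: (boolP [exists o : 'I_k, f o && ~~ f (if val o is o'.+1 then o' else k.-1)]).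
  case/existsP=> o /andP[fo fo']; exists (val o); first exact: ltn_ord.
  exact: block_from (ltn_ord o) b1 fo fo'.
rewrite negb_exists => /forallP H.
have up o : o < k -> ~~ f (if o is o'.+1 then o' else k.-1) -> ~~ f o.
  move=> ok fo'; move: (H (Ordinal ok)) => /=; rewrite negb_and => /orP[//|].
  by rewrite (negbTE fo').
have tail n : i + n < k -> ~~ f (i + n).
  by elim: n => [|n IH] ink; [rewrite addn0 | rewrite addnS; apply: up; [|apply: IH]; lia].
have z n : n < k -> ~~ f n.
  elim: n => [|n IH] nk; last by apply: up => //; apply: IH; lia.
  by apply: up => //; rewrite -(subnKC (_ : i <= k.-1)); [apply: tail|]; lia.
by exists 0; [lia | move=> j jk fj; move: (z j jk); rewrite fj].
Qed.

(* Effect of whole runs: [runb] reads [b^(k-1)] after a long run of [a]s; [runa]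
   reads [a^(k-1)] after a long run of [b]s; [rekill] reads [b a^(k-1)] after a
   long run of [a]s; [copyb] reads [a b^(k-1)] after a long run of [b]s. *)
Definition runb f := keep (iter k.-2 meet f).
Definition runa f := kill (iter (k - 3) meet (copy f)).
Definition rekill f := kill (iter k.-1 meet f).
Definition copyb f := keep (iter k.-2 meet (copy f)).
(** One full turn of the register, for runs that stay short after a long run of [b]s. *)
Definition erode f := iter k.-1 meet (copy f).

Lemma runbE f i : i < k -> runb f i =
  if i == 0 then f k.-1 else if i == k.-1 then f k.-2 else f i.-1 && f i.
Proof.
move=> ik; rewrite /runb /keep {1}/push; case: (i =P k.-1) => [->|ne].
  by rewrite iter_meetE; try lia; rewrite ifT ?ifF //; lia.
rewrite iter_meetE; try lia.
case: i ik ne => [|i] ik ne /=; first by rewrite ifT; [congr f|]; lia.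
by rewrite ifF; [congr (f _ && f _)|]; lia.
Qed.

Lemma runaE f i : i < k -> runa f i =
  if i == 0 then f k.-1 else if i == k.-1 then true else if i == 1 then f 1 else f i.-1 && f i.
Proof.
move=> ik; rewrite /runa /kill {1}/push; case: (i =P k.-1) => [->|ne].
  by rewrite ifF //; lia.
rewrite iter_meetE; try lia.
rewrite /copy /push.
case: i ik ne => [|[|i]] ik ne /=.
- by rewrite ifT ?ifF; [congr f| |]; lia.
- by rewrite ifT ?ifT; lia.
by rewrite ifF ?ifF ?ifF; [congr (f _ && f _)| | |]; lia.
Qed.

Lemma rekillE f i : i < k -> rekill f i = if i == k.-1 then true else f i && f i.+1.
Proof.
move=> ik; rewrite /rekill /kill {1}/push; case: (i =P k.-1) => [//|ne].
by rewrite iter_meetE; try lia; rewrite ifF; [congr (f _ && f _)|]; lia.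
Qed.

Lemma copybE f i : i < k -> copyb f i =
  if i == 0 then f 1 else if i == k.-1 then f k.-1 else f i && f i.+1.
Proof.
move=> ik; rewrite /copyb /keep {1}/push; case: (i =P k.-1) => [->|ne].
  rewrite iter_meetE /copy /push; try lia.
  by rewrite ifT ?ifF ?ifF; [congr f| | |]; lia.
rewrite iter_meetE /copy /push; try lia.
case: i ik ne => [|i] ik ne /=; first by rewrite ifT ?ifT //; lia.
by rewrite ifF ?ifF ?ifF; [congr (f _ && f _)| | |]; lia.
Qed.

Lemma erodeE f i : i < k -> erode f i =
  if i == 0 then f 1 else if i == k.-1 then f k.-1 && f 1 else f i && f i.+1.
Proof.
move=> ik; rewrite /erode iter_meetE /copy /push; try lia.
case: i ik => [|i] ik /=; first by rewrite ifT ?ifT //; lia.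
rewrite ifF; last by lia.
case: (i.+1 =P k.-1) => ne.
  by rewrite ifF ?ifT; [congr (f _ && f _)| |]; lia.
by rewrite ifF ?ifF; [congr (f _ && f _)| |]; lia.
Qed.

(** * How long runs change the number of adjacent dead pairs *)

Definition both f i := f i && f i.+1.

(** Interior cells become [both f], so by [sum_pairs] their new pairs are the old ones minus the
    descents of [both f]; the boundary cells are settled by cases. By the second bound, a run that
    loses no pair leaves at most one block. *)
Lemma runb_count f :
  pairs (runb f) <= pairs f /\ ndead (runb f) <= (pairs f).+1.
Proof.
have e1 : k - 3 = k.-2.-1 by lia.
have e2 : k.-2.+1 = k.-1 by lia.
have e3 : (k - 3).+1 = k.-2 by lia.
have h0 : runb f 0 = f k.-1 by rewrite runbE //; lia.
have hl : runb f k.-1 = f k.-2.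
  by rewrite runbE; [rewrite eqxx; case: eqP => //; lia | lia..].
have h i : i < k - 3 + 1 -> runb f i.+1 = both f i.
  by move=> ik; rewrite runbE; [do ?[case: eqP => //]; lia | lia..].
have pE : pairs (runb f) = (f k.-1 && both f 0)
    + \sum_(0 <= i < k - 3) (both f i && both f i.+1)
    + (both f (k - 3) && f k.-2) + (f k.-2 && f k.-1).
  rewrite pairsE big_ltn; last by lia.
  rewrite sum_shift sum_last; last by lia.
  rewrite h0 hl h; last by lia.
  rewrite -e1 e3 e2 hl -e3 h; last by lia.
  rewrite (@eq_sum _ (fun i => both f i && both f i.+1)); last first.
    by move=> i hi; rewrite !h //; lia.
  by rewrite !addnA.
have cE : ndead (runb f) = f k.-1 + \sum_(0 <= i < k - 3) (both f i : nat)
    + both f (k - 3) + f k.-2.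
  rewrite ndeadE big_ltn; last by lia.
  rewrite sum_shift sum_last; last by lia.
  rewrite -e1 h0 hl h; last by lia.
  rewrite (@eq_sum _ (fun i => both f i : nat)); last first.
    by move=> i hi; rewrite !h //; lia.
  by rewrite !addnA.
have fE : pairs f = \sum_(0 <= i < k - 3) (both f i : nat) + both f (k - 3)
    + both f k.-2 + (f k.-1 && f 0).
  rewrite pairsE sum_last; last by lia.
  rewrite sum_last; last by lia.
  by rewrite -e1.
have d : both f 0 <= both f (k - 3) + desc (both f) 0 (k - 3) by apply: desc_ge.
move: d; rewrite pE cE fE (sum_pairs (both f)); move: (\sum_(0 <= i < k - 3) _) (desc _ _ _) => x r.
rewrite /both e3 e2.
case: (f 0); case: (f 1); case: (f (k - 3)); case: (f k.-2); case: (f k.-1) => /=; clear; lia.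
Qed.

(* The last case is the only way to gain two pairs: the copy joins the isolated
   dead cell [k - 1] to the block that starts at cell [1]. *)
Lemma runa_count f : k - 3 <= pairs f \/
  pairs (runa f) <= (pairs f).+1 \/
  [/\ pairs (runa f) = (pairs f).+2, f k.-1, f 1, ~~ f k.-2 &
      ndead (runa f) <= (pairs (runa f)).+1].
Proof.
have e1 : k - 3 = k.-2.-1 by lia.
have e2 : k.-2.+1 = k.-1 by lia.
have e3 : (k - 3).+1 = k.-2 by lia.
have h0 : runa f 0 = f k.-1 by rewrite runaE //; lia.
have h1 : runa f 1 = f 1.
  by rewrite runaE; [case: eqP => //; case: eqP => //; lia | lia..].
have hl : runa f k.-1.
  by rewrite runaE; [rewrite eqxx; case: eqP => //; lia | lia..].
have h i : 0 < i < k - 3 + 1 -> runa f i.+1 = both f i.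
  by move=> ik; rewrite runaE; [do ?[case: eqP => //]; lia | lia..].
have pE : pairs (runa f) = (f k.-1 && f 1) + (f 1 && both f 1)
    + \sum_(1 <= i < k - 3) (both f i && both f i.+1)
    + both f (k - 3) + f k.-1.
  rewrite pairsE big_ltn; last by lia.
  rewrite sum_shift sum_last; last by lia.
  rewrite big_ltn; last by lia.
  rewrite h0 hl h1 h; last by lia.
  rewrite -e1 e3 e2 hl -e3 h; last by lia.
  rewrite (@eq_sum _ (fun i => both f i && both f i.+1)); last first.
    by move=> i hi; rewrite !h //; lia.
  by rewrite !addnA andbT.
have cE : ndead (runa f) = f k.-1 + f 1 + \sum_(1 <= i < k - 3) (both f i : nat)
    + both f (k - 3) + 1.
  rewrite ndeadE big_ltn; last by lia.
  rewrite sum_shift sum_last; last by lia.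
  rewrite big_ltn; last by lia.
  rewrite -e1 h0 hl h1 h; last by lia.
  rewrite (@eq_sum _ (fun i => both f i : nat)); last first.
    by move=> i hi; rewrite !h //; lia.
  by rewrite !addnA.
have fE : pairs f = both f 0 + \sum_(1 <= i < k - 3) (both f i : nat) + both f (k - 3)
    + both f k.-2 + (f k.-1 && f 0).
  rewrite pairsE sum_last; last by lia.
  rewrite sum_last; last by lia.
  by rewrite -e1 big_ltn //; lia.
have d : both f 1 <= both f (k - 3) + desc (both f) 1 (k - 3) by apply: desc_ge; clear -hk; lia.
(* If [both f] holds at [1] and has no descent, it holds up to [k - 3], and the register is almost
   full. *)
have [z|nz] := boolP ((desc (both f) 1 (k - 3) == 0) && both f 1).
  left; case/andP: z => /eqP z b1; rewrite fE.
  have lek : 1 <= k - 3 by clear -hk; lia.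
  have [ge ->] := desc0_sum lek z b1.
  by move: ge; move: (\sum_(1 <= i < k - 3) _) => x; clear -hk; lia.
right; case: leqP => [|gt]; [by left | right; move: gt nz d]; rewrite pE cE fE (sum_pairs (both f)).
move: (\sum_(1 <= i < k - 3) _) (desc _ _ _) => x r.
rewrite /both e3 e2.
by case: (f 0); case: (f 1); case: (f 2); case: (f (k - 3)); case: (f k.-2);
  case: (f k.-1) => /=; clear => gt nz d; split; lia.
Qed.

(** A new pair of the killed cell with cell [0] is paid for by a descent of [both f] or, if there is
    none, by the old pair of cells [k - 1] and [0]. *)
Lemma rekill_count f : pairs (rekill f) <= pairs f.
Proof.
have e2 : k.-2.+1 = k.-1 by lia.
have hl : rekill f k.-1 by rewrite rekillE ?eqxx //; lia.
have h i : i < k.-1 -> rekill f i = both f i.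
  by move=> ik; rewrite rekillE; [do ?[case: eqP => //]; lia | lia..].
have pE : pairs (rekill f) = \sum_(0 <= i < k.-2) (both f i && both f i.+1)
    + both f k.-2 + both f 0.
  rewrite pairsE sum_last; last by lia.
  rewrite e2 hl h; last by lia.
  rewrite h; last by lia.
  rewrite (@eq_sum _ (fun i => both f i && both f i.+1)) ?andbT //.
  by move=> i hi; rewrite !h //; lia.
have fE : pairs f = \sum_(0 <= i < k.-2) (both f i : nat) + both f k.-2 + (f k.-1 && f 0).
  by rewrite pairsE sum_last //; lia.
have d : both f 0 <= both f k.-2 + desc (both f) 0 k.-2 by apply: desc_ge.
move: d; rewrite pE fE (sum_pairs (both f)); move: (\sum_(0 <= i < k.-2) _) (desc _ _ _) => x r.
rewrite /both e2.
by case: (f 0); case: (f 1); case: (f k.-2); case: (f k.-1) => /=; clear; lia.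
Qed.

Lemma copyb_count f : k.-2 <= pairs f \/
  pairs (copyb f) <= (pairs f).+1 /\ ndead (copyb f) <= (pairs f).+2.
Proof.
have e2 : k.-2.+1 = k.-1 by lia.
have h0 : copyb f 0 = f 1 by rewrite copybE //; lia.
have hl : copyb f k.-1 = f k.-1.
  by rewrite copybE; [rewrite eqxx; case: eqP => //; lia | lia..].
have h i : 0 < i < k.-1 -> copyb f i = both f i.
  by move=> ik; rewrite copybE; [do ?[case: eqP => //]; lia | lia..].
have pE : pairs (copyb f) = (f 1 && both f 1)
    + \sum_(1 <= i < k.-2) (both f i && both f i.+1)
    + (both f k.-2 && f k.-1) + (f k.-1 && f 1).
  rewrite pairsE big_ltn; last by lia.
  rewrite sum_last; last by lia.
  rewrite e2 h0 hl h; last by lia.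
  rewrite h; last by lia.
  rewrite (@eq_sum _ (fun i => both f i && both f i.+1)); last first.
    by move=> i hi; rewrite !h //; lia.
  by rewrite !addnA.
have cE : ndead (copyb f) = f 1 + \sum_(1 <= i < k.-2) (both f i : nat)
    + both f k.-2 + f k.-1.
  rewrite ndeadE big_ltn; last by lia.
  rewrite sum_last; last by lia.
  rewrite h0 hl h; last by lia.
  rewrite (@eq_sum _ (fun i => both f i : nat)); last first.
    by move=> i hi; rewrite !h //; lia.
  by rewrite !addnA.
have fE : pairs f = both f 0 + \sum_(1 <= i < k.-2) (both f i : nat) + both f k.-2
    + (f k.-1 && f 0).
  rewrite pairsE sum_last; last by lia.
  by rewrite big_ltn //; lia.
have d : both f 1 <= both f k.-2 + desc (both f) 1 k.-2 by apply: desc_ge; clear -hk; lia.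
have [z|nz] := boolP ((desc (both f) 1 k.-2 == 0) && both f 1).
  left; case/andP: z => /eqP z b1; rewrite fE.
  have lek : 1 <= k.-2 by clear -hk; lia.
  have [ge ->] := desc0_sum lek z b1.
  by move: ge; move: (\sum_(1 <= i < k.-2) _) => x; clear -hk; lia.
right; move: nz d; rewrite pE cE fE (sum_pairs (both f)).
move: (\sum_(1 <= i < k.-2) _) (desc _ _ _) => x r.
rewrite /both e2.
by case: (f 0); case: (f 1); case: (f 2); case: (f k.-2);
  case: (f k.-1) => /=; clear => nz d; split; lia.
Qed.

(** The killed cell becomes a neighbour of old cell [2]. If old cell [1] was dead too, this only
    replaces the pair of cells [1] and [2]. *)
Lemma kill_meet_count f : pairs (kill (meet f)) <= pairs f + (f 2 && ~~ f 1).
Proof.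
have e2 : k.-2.+1 = k.-1 by lia.
have e1 : k - 3 = k.-2.-1 by lia.
have e3 : (k - 3).+1 = k.-2 by lia.
have hl : kill (meet f) k.-1 by rewrite /kill /push eqxx.
have hm : kill (meet f) k.-2 = f 0 && f 1.
  by rewrite /kill /meet /push ifF ?ifT //; lia.
have h i : i < k.-2 -> kill (meet f) i = f i.+2.
  by move=> ik; rewrite /kill /meet /push ifF ?ifF //; lia.
have pE : pairs (kill (meet f)) = \sum_(0 <= i < k - 3) (both f i.+2 : nat)
    + (f k.-1 && (f 0 && f 1)) + (f 0 && f 1) + f 2.
  rewrite pairsE sum_last; last by lia.
  rewrite sum_last; last by lia.
  rewrite e2 hl hm -e1 e3 hm h; last by lia.
  rewrite h; last by lia.
  rewrite (@eq_sum _ (fun i => both f i.+2 : nat)); last first.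
    by move=> i hi; rewrite !h //; lia.
  by rewrite (_ : (k - 3).+2 = k.-1) ?andbT //; lia.
have fE : pairs f = both f 0 + both f 1 + \sum_(0 <= i < k - 3) (both f i.+2 : nat)
    + (f k.-1 && f 0).
  rewrite pairsE big_ltn; last by lia.
  rewrite big_ltn; last by lia.
  rewrite 2!sum_shift.
  by rewrite (_ : k.-1.-1.-1 = k - 3) ?addnA //; lia.
rewrite pE fE; move: (\sum_(0 <= i < k - 3) _) => x; rewrite /both.
by case: (f 0); case: (f 1); case: (f 2); case: (f k.-1) => /=; clear; lia.
Qed.

(** * The potential *)

Definition q := 5 * k - 4.
Lemma qE : q + 4 = 5 * k.
Proof. by rewrite /q; lia. Qed.

(* [leA t o n] and [leB t o n] bound from below the time [t] at which the dead
   cells can fill [iv o n], when the last long run consists of [a]s or of [b]s;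
   [genA] and [genB] do the same for an arbitrary register with at most [m]
   adjacent dead pairs.  The constants were read off from the exact optima for
   small [k].  All inequalities are written without subtraction. *)
Definition leA t o n : Prop :=
  [/\ n = 1 -> k <= t + o + 1 /\ (k <= o + 2 -> 2 * k <= t + o + 1),
      n.+1 = k -> q * k + 13 <= t + o + 14 * k &
      1 < n -> n + 2 <= k -> q * n + 6 <= t + o + 7 * k /\
        (k <= o + n + 1 -> q * n + 6 + k <= t + o + 7 * k)].

Definition leB t o n : Prop :=
  [/\ n = 1 -> 2 * k <= t + o + 1 /\ (k = o + 1 -> 3 * k <= t + o + 1),
      n.+1 = k -> q * k + 13 <= t + o + 14 * k /\
        (0 < o -> q * k + 13 + k <= t + o + 14 * k) &
      1 < n -> n + 2 <= k -> q * n + 6 <= t + o + 6 * k /\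
        (0 < o -> q * n + 6 + k <= t + o + 6 * k)].

(* [t] is at least the claimed bound [5 k ^ 2 - 17 k + 13]. *)
Definition late t := q * k + 13 <= t + 13 * k.
Definition genA t f m := pairs f <= m /\ q * m + k + 1 <= t + ~~ f k.-2.
Definition genB t f m := pairs f <= m /\ q * m + 7 * k <= t + 4 + ~~ f k.-1.
Definition oneA t f o n := [/\ o < k, 0 < n < k, leA t o n & sub f (iv o n)].
Definition oneB t f o n := [/\ o < k, 0 < n < k, leB t o n & sub f (iv o n)].

Definition certA t f := [\/ late t, exists m, genA t f m | exists o n, oneA t f o n].
Definition certB t f := [\/ late t, exists m, genB t f m | exists o n, oneB t f o n].

(** This justifies enlarging the register, for instance by relaxing [meet] to [keep]. *)
Lemma certA_sub t f g : sub g f -> certA t f -> certA t g.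
Proof.
move=> gf [d|[m [pm le]]|[o [n [ok nk le fi]]]]; first exact: Or31.
  apply: Or32; exists m; split; first exact: leq_trans (pairs_sub gf) pm.
  apply: leq_trans le _; rewrite leq_add2l.
  have k2 : k.-2 < k by lia.
  by case: (g k.-2) (gf _ k2) => [->|_] //; case: (f _).
by apply: Or33; exists o, n; split=> //; exact: sub_trans gf fi.
Qed.

Lemma certB_sub t f g : sub g f -> certB t f -> certB t g.
Proof.
move=> gf [d|[m [pm le]]|[o [n [ok nk le fi]]]]; first exact: Or31.
  apply: Or32; exists m; split; first exact: leq_trans (pairs_sub gf) pm.
  apply: leq_trans le _; rewrite leq_add2l.
  have k2 : k.-1 < k by lia.
  by case: (g k.-1) (gf _ k2) => [->|_] //; case: (f _).
by apply: Or33; exists o, n; split=> //; exact: sub_trans gf fi.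
Qed.

Lemma lateW t s : t <= s -> late t -> late s.
Proof. by rewrite /late; lia. Qed.

Lemma q_mulS m : q * m.+1 = q * m + q.
Proof. by rewrite mulnS addnC. Qed.

(** Disposes of almost full registers, so that the intervals considered afterwards have fewer than
    [k] cells. *)
Lemma late_large m t c : k <= m + c -> q * m + q * c + 13 <= t + 13 * k -> late t.
Proof.
move=> km h; rewrite /late; apply: leq_trans h; rewrite -mulnDr leq_add2r.
by rewrite leq_mul2l km orbT.
Qed.

Lemma iv_rot f o n (r : nat) : o < k -> n < k -> r <= k -> sub f (iv o n) ->
  sub (iter r keep f) (iv (if r <= o then o - r else o + k - r) n).
Proof.
move=> ok nk rk fi i ik; rewrite iter_keepE //.
case: (ltnP (i + r) k) => h /fi; rewrite /iv; case: (leqP r o) => ro.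
- by clear -h ro ik rk ok nk; lia.
- by clear -h ro ik rk ok nk; lia.
- by clear -h ro ik rk ok nk; lia.
by clear -h ro ik rk ok nk; lia.
Qed.

Lemma pairs_iv f o n : o < k -> 0 < n < k -> sub f (iv o n) -> pairs f <= n.-1.
Proof.
move=> ok nk fi; rewrite -(pairs_iter_keep o).
have {}fi : sub (iter o keep f) (iv 0 n).
  by have := @iv_rot f o n o ok _ _ fi; rewrite leqnn subnn; apply; lia.
apply: (@pairs_le _ 0) => i ik /(fi _ ik); rewrite /iv /succk.
case: eqP => [-> a _|ne a /(fi i.+1)]; first by move: a; clear -hk nk; lia.
by rewrite /iv; lia.
Qed.

Lemma keep_iv f o n : o < k -> n < k -> sub f (iv o n) ->
  sub (keep f) (iv (if o is o'.+1 then o' else k.-1) n).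
Proof.
move=> ok nk fi; have := @iv_rot f o n 1 ok nk _ fi.
by case: o ok fi => [|o] ok fi /=; rewrite ?add0n ?subn1 /=; apply; lia.
Qed.

(** [keep] moves an interval one cell back while the time grows by one, so [t + o] is constant until
    the start wraps from [0] to [k - 1], where it grows by [k]. The conditional clauses of [leA]
    match this jump. *)
Lemma keep_certA t f : certA t f -> certA t.+1 (keep f).
Proof.
case=> [d|[m [pm le]]|[o [n [ok nk le fi]]]].
- by apply: Or31; apply: lateW d.
- apply: Or32; exists m; split; first by rewrite pairs_keep.
  by move: le; case: (f _); case: (keep f _); clear; lia.
apply: Or33; exists (if o is o'.+1 then o' else k.-1), n; split=> //.
- by case: (o) ok; lia.
- case: le => a b c; split; move: a b c; case: (o) ok; clear -hk nk; lia.
by apply: keep_iv => //; lia.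
Qed.

Lemma keep_certB t f : certB t f -> certB t.+1 (keep f).
Proof.
case=> [d|[m [pm le]]|[o [n [ok nk le fi]]]].
- by apply: Or31; apply: lateW d.
- apply: Or32; exists m; split; first by rewrite pairs_keep.
  by move: le; case: (f _); case: (keep f _); clear; lia.
apply: Or33; exists (if o is o'.+1 then o' else k.-1), n; split=> //.
- by case: (o) ok; lia.
- case: le => a b c; split; move: a b c; case: (o) ok; clear -hk nk; lia.
by apply: keep_iv => //; lia.
Qed.

Lemma pairs_full f : (forall i, i < k -> f i) -> k <= pairs f.
Proof.
move=> al; rewrite /pairs.
apply: leq_trans (@sum_true (fun i => f i && f (succk i)) 0 k _); first by rewrite subn0.
by move=> i /andP[_ ik]; rewrite !al ?succk_lt.
Qed.

Lemma block_some f : pairs f < k -> ndead f <= (pairs f).+1 ->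
  exists2 o, o < k & sub f (iv o (pairs f).+1).
Proof.
move=> pk b1; apply: block_any => //.
case: (boolP [forall i : 'I_k, f i]) => [/forallP al|]; last first.
  by rewrite negb_forall => /existsP[i fi]; exists i.
move: pk; rewrite ltnNge; case/negP.
by apply: pairs_full => i ik; exact: (al (Ordinal ik)).
Qed.

Lemma sub0_iv f o n : (forall i, i < k -> ~~ f i) -> sub f (iv o n).
Proof. by move=> z i ik fi; move: (z i ik); rewrite fi. Qed.

(** * Effect of long runs on certificates *)

Lemma runb_cert t f : certA t f -> certB (t + k.-1) (runb f).
Proof.
have qe := qE.
case=> [d|[m [pm le]]|[o [n [ok nk le fi]]]].
- by apply: Or31; apply: lateW d; lia.
- have [c1 c2] := runb_count f.
  have hl : runb f k.-1 = f k.-2.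
    by rewrite runbE; [rewrite eqxx; case: eqP => //; lia | lia..].
  case: (ltnP k.-2 m.+1) => [mk|mk].
    apply: Or31; apply: (@late_large m _ 2); first by lia.
    by move: le qe; case: (f _); clear -hk; lia.
  (* If a pair is lost, the constants match exactly: [q + (k + 1) + (k - 1) + 4 = 7 * k], and [hl]
     passes on the bit. Otherwise [runb_count] leaves at most one block. *)
  case: (ltnP (pairs (runb f)) m) => [lt|ge].
    case: m pm le mk lt => // m pm le mk lt.
    apply: Or32; exists m; split; first by lia.
    by rewrite hl; move: le; rewrite q_mulS; case: (f _); clear -hk qe; lia.
  have em : pairs (runb f) = m by clear -ge pm c1; lia.
  case: (@block_some (runb f)) => [||o ok]; [by rewrite em; lia| by rewrite em; lia|].
  rewrite em => fi; case: m pm le mk ge em fi => [|m] pm le mk ge em fi.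
    (* If the only candidate is cell [k - 1] and it is alive, no cell is dead, and the cheaper
       position [0] can be claimed. *)
    case: (boolP ((o == k.-1) && ~~ f k.-2)) => [/andP[/eqP eo nf]|H].
      apply: Or33; exists 0, 1; split=> //; try (clear -hk; lia).
        by split; move: le; rewrite nf; clear -hk; lia.
      apply: sub0_iv => i ik; apply/negP => fbi; move: (fi i ik fbi).
      rewrite /iv eo => hi; have ei : i = k.-1 by move: hi ik; clear -hk; lia.
      by move: fbi; rewrite ei hl (negbTE nf).
    apply: Or33; exists o, 1; split=> //; first by clear -hk; lia.
    by split; move: le H; case: (f _); clear -hk; lia.
  apply: Or33; exists o, m.+2; split=> //; first by clear -mk; lia.
  by split; move: le; rewrite !q_mulS; case: (f _); clear -hk qe mk; lia.
have sh : sub (runb f) (iv (if o.+1 == k then 0 else o.+1) n).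
  move=> i ik; rewrite runbE //; case: eqP => [->|i0].
    by move=> /fi; rewrite /iv; case: ifP; clear -hk ok nk; lia.
  case: eqP => [->|i1].
    by move=> /fi; rewrite /iv; case: ifP; clear -hk ok nk; lia.
  move=> /andP[/fi]; rewrite /iv => a _; move: a.
  by case: ifP; clear -hk ok nk i0 i1 ik; lia.
(* An interval of at least two cells ending before cell [k - 2] lies inside the sweep and loses a
   cell. In the other cases the shift [sh] suffices. *)
case: (boolP [&& 1 < n, n + 2 <= k & o + n + 2 <= k]) => [/and3P[n1 n2 on]|H].
  apply: Or33; exists o.+1, n.-1; split; [by clear -on n1; lia|by clear -n1 n2; lia| |].
    case: le => _ _ /(_ n1 n2) [le _].
    have {}le : q * n.-1 + q + 6 <= t + o + 7 * k.
      by move: le; case: (n) n1 => // m _; rewrite q_mulS.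
    have e : n.-1 = 1 -> q * n.-1 = q by move=> ->; rewrite muln1.
    by split; clear -hk n1 n2 on qe e le; lia.
  move=> i ik; rewrite runbE //; case: eqP => [->|i0].
    by move=> /fi; rewrite /iv; clear -hk ok nk on; lia.
  case: eqP => [->|i1].
    by move=> /fi; rewrite /iv; clear -hk ok nk on; lia.
  move=> /andP[/fi a /fi b]; move: a b; rewrite /iv.
  by clear -hk ok nk on i0 i1 ik; lia.
apply: Or33; exists (if o.+1 == k then 0 else o.+1), n; split=> //; first by case: eqP; lia.
case: le => a b c; split; move: a b c H; case: eqP; clear -hk nk ok; lia.
Qed.

Ltac ivlia fi := rewrite ?/succk; do ?[case: eqP => ?];
  repeat first [case/andP | move=> /fi ? | move=> _]; unfold iv in *; lia.

(** An interval that starts at [0] or contains [k - 1] joins the killed cell and gets no longer. Any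
    other interval shrinks and stays apart from it. *)
Lemma rekill_cert t f : certA t f -> certA (t + k) (rekill f).
Proof.
have qe := qE.
case=> [d|[m [pm le]]|[o [n [ok nk le fi]]]].
- by apply: Or31; apply: lateW d; lia.
- apply: Or32; exists m; split; first exact: leq_trans (rekill_count f) pm.
  by move: le; case: (f _); case: (rekill f _); clear -hk; lia.
case: (posnP o) => [o0|o1].
  apply: Or33; exists k.-1, n; split=> //; first by clear -hk; lia.
    by case: le => a b c; split; move: a b c; clear -hk nk o0; lia.
  by move=> i ik; clear le; rewrite (rekillE f ik); ivlia fi.
case: (leqP k (o + n)) => on.
  apply: Or33; exists o, n; split=> //.
    by case: le => a b c; split; move: a b c; clear -hk nk on; lia.
  by move=> i ik; clear le; rewrite (rekillE f ik); ivlia fi.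
case: (ltnP 1 n) => n1.
  apply: Or32; exists n.-2; split.
    apply: (@pairs_le _ o) => i ik; clear le.
    by rewrite (rekillE f ik) (rekillE f (succk_lt ik)); ivlia fi.
  case: le => _ _ /(_ n1) le.
  have : q * n = q * n.-2 + q + q by case: (n) n1 => [|[|m]] // _; rewrite !q_mulS.
  by move: le; case: (rekill f _); clear -hk nk on o1 n1 qe; lia.
apply: Or33; exists k.-1, 1; split=> //; try (by clear -hk; lia).
  by case: le => a b c; split; move: a b c; clear -hk nk n1; lia.
by move=> i ik; clear le; rewrite (rekillE f ik); ivlia fi.
Qed.

(** In the interval case, the copy spares an interval that starts at [1] from shrinking. The killed
    cell is either absorbed by an interval next to it or stays isolated and adds no pair. *)
Lemma runa_cert t f : certB t f -> certA (t + k.-1) (runa f).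
Proof.
have qe := qE.
have hl : runa f k.-1 by rewrite runaE; [rewrite eqxx; case: eqP => //; lia | lia..].
case=> [d|[m [pm le]]|[o [n [ok nk le fi]]]].
- by apply: Or31; apply: lateW d; lia.
- case: (leqP (k - 3) m) => mk.
    apply: Or31; apply: (@late_large m _ 3); first by lia.
    by move: le; case: (f _); clear -hk qe; lia.
  case: (leqP (pairs (runa f)) m.+1) => pa.
    apply: Or32; exists m.+1; split=> //.
    by move: le; rewrite q_mulS; case: (f _); case: (runa f _); clear -hk qe; lia.
  case: (runa_count f) => [big|[le'|[ep fl f1 fl2 b1]]].
  + by exfalso; move: big pm mk; clear; lia.
  + by exfalso; move: le' pa pm; clear; lia.
  have em : pairs f = m by clear -pm pa ep; lia.
  have ef : sub (runa f) (iv k.-1 m.+3).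
    rewrite -em -ep; apply: block_from => //; first by lia.
    rewrite (_ : k.-1 = k.-2.+1); last by lia.
    rewrite runaE; [|by lia..]; case: eqP; first by lia.
    move=> _; case: eqP; first by lia.
    by move=> _; case: eqP; [lia | rewrite (negbTE fl2) andbF].
  move: le; rewrite fl addn0 => le.
  apply: Or33; exists k.-1, m.+3; split=> //; try (by clear -hk mk; lia).
  have : m.+4 = k -> q * k = q * m + q + q + q + q by move=> <-; rewrite !q_mulS.
  by split; move: le; rewrite ?q_mulS; clear -hk qe mk; lia.
case: (leqP n 1) => [n1|n1].
  case: (o =P k.-1) => [eo|no].
    apply: Or33; exists k.-1, 2; split=> //; try (by clear -hk; lia).
      by case: le => a b c; split; move: a b c; rewrite ?(mulnC _ 2); clear -hk nk n1 eo qe; lia.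
    by move=> i ik; clear le; rewrite (runaE f ik); ivlia fi.
  apply: Or32; exists 0; split.
    apply: (@pairs_le _ 0) => i ik; clear le.
    by rewrite (runaE f ik) (runaE f (succk_lt ik)); ivlia fi.
  by case: le => a _ _; case: (runa f _); move: a; clear -hk nk n1 ok no; lia.
case: (o =P k.-1) => [eo|no].
  apply: Or33; exists k.-1, n; split=> //; first by clear -hk; lia.
    by case: le => a b c; split; move: a b c; clear -hk nk n1 eo qe; lia.
  by move=> i ik; clear le; rewrite (runaE f ik); ivlia fi.
case: (leqP 2 o) => o2; [case: (leqP k.-1 (o + n)) => on|].
- apply: Or33; exists o.+1, n; split=> //; first by clear -ok no; lia.
    by case: le => a b c; split; move: a b c; clear -hk nk n1 o2 on ok qe; lia.
  by move=> i ik; clear le; rewrite (runaE f ik); ivlia fi.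
- apply: Or32; exists n.-2; split.
    apply: (@pairs_le _ o.+1) => i ik; clear le.
    by rewrite (runaE f ik) (runaE f (succk_lt ik)); ivlia fi.
  case: le => _ _ /(_ n1) le.
  have : q * n = q * n.-2 + q + q by case: (n) n1 => [|[|m]] // _; rewrite !q_mulS.
  by move: le; case: (runa f _); clear -hk nk on o2 n1 qe; lia.
case: (posnP o) => [o0|o1].
  case: (n.+1 =P k) => [en|nn].
    apply: Or33; exists 1, n; split=> //; first by clear -hk; lia.
      by case: le => a b c; split; move: a b c; clear -hk en o0; lia.
    by move=> i ik; clear le; rewrite (runaE f ik); ivlia fi.
  apply: Or32; exists n.-2; split.
    apply: (@pairs_le _ 1) => i ik; clear le.
    by rewrite (runaE f ik) (runaE f (succk_lt ik)); ivlia fi.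
  case: le => _ _ /(_ n1) le.
  have : q * n = q * n.-2 + q + q by case: (n) n1 => [|[|m]] // _; rewrite !q_mulS.
  by move: le; case: (runa f _); clear -hk nk nn o0 n1 qe; lia.
have eo : o = 1 by clear -o1 o2; lia.
case: (n.+1 =P k) => [en|nn].
  apply: Or31; case: le => _ /(_ en) [_ le] _; move: le; rewrite /late.
  by clear -hk eo; lia.
case: (n.+2 =P k) => [en|nn2].
  apply: Or33; exists 1, n.+1; split=> //; try (by clear -hk en; lia).
    case: le => a b c; split; move: a b c; rewrite ?q_mulS.
    + by clear -n1; lia.
    + rewrite -en !q_mulS; clear -hk en eo n1 qe; lia.
    by clear -en; lia.
  by move=> i ik; clear le; rewrite (runaE f ik); ivlia fi.
apply: Or32; exists n.-1; split.
  apply: (@pairs_le _ 1) => i ik; clear le.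
  by rewrite (runaE f ik) (runaE f (succk_lt ik)); ivlia fi.
(* The bound is missed by one, which the live cell [k - 2] makes up through the bit in [genA]. *)
have bit : ~~ runa f k.-2.
  have k2 : k.-2 < k by lia.
  by apply/negP; clear le; rewrite (runaE f k2); ivlia fi.
rewrite bit; case: le => _ _ /(_ n1) le.
have : q * n = q * n.-1 + q by case: (n) n1 => [|m] // _; rewrite !q_mulS.
by move: le; clear -hk nk nn eo n1 qe; lia.
Qed.

(** Only an interval starting at [1] moves: it gains cell [0] by the copy and loses its last
    cell. *)
Lemma copyb_cert t f : certB t f -> certB (t + k) (copyb f).
Proof.
have qe := qE.
case=> [d|[m [pm le]]|[o [n [ok nk le fi]]]].
- by apply: Or31; apply: lateW d; lia.
- case: (leqP k.-2 m) => mk.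
    apply: Or31; apply: (@late_large m _ 2); first by lia.
    by move: le; case: (f _); clear -hk qe; lia.
  case: (leqP (pairs (copyb f)) m) => pa.
    apply: Or32; exists m; split=> //.
    by move: le; case: (f _); case: (copyb f _); clear -hk qe; lia.
  case: (copyb_count f) => [big|[p1 c1]].
    by exfalso; move: big pm mk; clear; lia.
  have em : pairs (copyb f) = m.+1 by clear -pm pa p1; lia.
  have [||o ok] := @block_some (copyb f).
  + by rewrite em; clear -mk; lia.
  + by rewrite em; clear -c1 pm; lia.
  rewrite em => fi.
  apply: Or33; exists o, m.+2; split=> //; first by clear -mk; lia.
  have : m.+3 = k -> q * k = q * m + q + q + q by move=> <-; rewrite !q_mulS.
  by split; move: le; case: (f _); rewrite ?q_mulS; clear -hk qe mk; lia.
case: (o =P 1) => [o1|no].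
  case: (n.+1 =P k) => [en|nn].
    apply: Or31; case: le => _ /(_ en) [_ le] _; move: le; rewrite /late.
    by clear -hk o1; lia.
  apply: Or33; exists 0, n; split=> //; first by clear -hk; lia.
    by case: le => a b c; split; move: a b c; clear -hk nk nn o1; lia.
  move=> i ik; rewrite copybE //; case: eqP => [->|i0].
    by rewrite /iv; clear -hk nk; lia.
  case: eqP => [->|i1]; first by move=> /fi; rewrite /iv; clear -hk nk o1 nn; lia.
  move=> /andP[/fi a /fi b]; move: a b; rewrite /iv.
  by clear -hk nk ik i1 o1 nn; lia.
apply: Or33; exists o, n; split=> //.
  by case: le => a b c; split; move: a b c; clear -hk nk; lia.
move=> i ik; rewrite copybE //; case: eqP => [->|i0].
  by move=> /fi; rewrite /iv; clear -hk nk no ok; lia.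
case: eqP => [->|i1]; first by move=> /fi; apply; lia.
by move=> /andP[/fi a _]; apply: a.
Qed.

Lemma iv_not_full f o n : o < k -> n < k -> sub f (iv o n) -> ~ (forall i, i < k -> f i).
Proof.
move=> ok nk fi al; have := fi _ _ (al (if o is o'.+1 then o' else k.-1) _).
by rewrite /iv; case: (o) ok; clear -hk nk => *; lia.
Qed.

Lemma certA_full t f : certA t f -> (forall i, i < k -> f i) -> late t.
Proof.
have qe := qE.
case=> [//|[m [pm le]]|[o [n [ok /andP[_ nk] le fi]]]] al; last by case: (iv_not_full ok nk fi).
apply: (@late_large m _ 0); last by move: le; case: (f _); rewrite muln0; clear -hk; lia.
by rewrite addn0; apply: leq_trans pm; apply: pairs_full.
Qed.

Lemma certB_full t f : certB t f -> (forall i, i < k -> f i) -> late t.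
Proof.
have qe := qE.
case=> [//|[m [pm le]]|[o [n [ok /andP[_ nk] le fi]]]] al; last by case: (iv_not_full ok nk fi).
apply: (@late_large m _ 0); last by move: le; case: (f _); rewrite muln0; clear -hk; lia.
by rewrite addn0; apply: leq_trans pm; apply: pairs_full.
Qed.

(** Before the copy all cells except possibly [0] are dead. For the interval of [k - 1] cells at
    [1], [leB] gives exactly [late t.+1], so the last letter counts. *)
Lemma certB_copy_full t f : certB t f -> (forall i, i < k -> copy f i) -> late t.+1.
Proof.
have qe := qE.
case=> [d|[m [pm le]]|[o [n [ok nk le fi]]]] al; first exact: lateW d.
  apply: lateW (leqnSn t) _; apply: (@late_large m _ 2).
    rewrite addn2; apply: leq_trans (_ : (pairs f).+2 <= _); last by rewrite !ltnS.
    rewrite pairsE big_ltn; last by lia.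
    have H i : 1 <= i < k -> f i.
      move=> ik; have := al i.-1; rewrite /copy /push.
      case: eqP => [|_ /(_ _)]; first by move: ik; clear; lia.
      by rewrite prednK; [apply; lia|lia].
    have := @sum_true (fun i => f i && f i.+1) 1 k.-1 _.
    move=> /(_ _) S; have := S ltac:(by move=> i ik; rewrite !H //; lia).
    by move: (\sum_(1 <= i < k.-1) _) => x; clear; lia.
  by move: le; case: (f _); clear -hk qe; lia.
have H i : 1 <= i < k -> iv o n i.
  move=> ik; apply: fi; first by lia.
  have := al i.-1; rewrite /copy /push.
  case: eqP => [|_ /(_ _)]; first by move: ik; clear; lia.
  by rewrite prednK; [apply; lia|lia].
have H1 := H 1; have Hl := H k.-1; have Ho := H o.-1.
move: H1 Hl Ho le; rewrite /iv /leB /late => H1 Hl Ho [a b c].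
by move: H1 Hl Ho a b c; clear -hk ok nk; lia.
Qed.

Lemma erode_copyb f : sub (erode f) (copyb f).
Proof.
move=> i ik; rewrite (erodeE f ik) (copybE f ik).
by do 2 (case: eqP => // _); case/andP.
Qed.

Lemma kill_meet_iv2 y n : n < k -> sub y (iv 2 n) -> sub (kill (meet y)) (iv k.-1 n.+1).
Proof.
move=> nk yi i ik; rewrite /kill /meet /push.
by do ?[case: eqP => ?]; repeat first [case/andP | move=> /yi ? | move=> _];
  unfold iv in *; lia.
Qed.

Lemma kill_meet_iv y o n : o < k -> o <> 2 -> 0 < n < k -> sub y (iv o n) ->
  pairs (kill (meet y)) <= n.-1.
Proof.
move=> ok o2 nk yi; have s : sub (kill (meet y)) (kill (meet (iv o n))).
  by apply: sub_kill => //; apply: sub_meet.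
apply: leq_trans (pairs_sub s) _; apply: leq_trans (kill_meet_count _) _.
rewrite (_ : _ && _ = false); last by rewrite /iv; lia.
by rewrite addn0; apply: pairs_iv ok nk _; apply: sub_refl.
Qed.

Lemma erode_iv f o n : o < k -> 1 < n < k -> o != 1 -> sub f (iv o n) ->
  sub (erode f) (iv o n.-1).
Proof. by move=> ok nk o1 fi i ik; rewrite (erodeE f ik); ivlia fi. Qed.

(* Reads [a^i b^j' a^(k-1)] with short [i] and [j'] after a long run of [b]s: the
   conjunctions between the first pass [erode] and the last one are relaxed to
   [keep]. *)
Lemma copya_cert t f j : j + 3 <= k -> certB t f ->
  certA (t + k + 1 + j) (kill (meet (iter (j + k.-1) keep (erode f)))).
Proof.
(* [k] rotations are the identity, so [j + k.-1] of them act as [j - 1], also when [j = 0]. Hence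
   the time is only [t + k + 1 + j]. *)
have qe := qE; move=> jk; set y := iter _ _ _.
case=> [d|[m [pm le]]|[o [n [ok nk le fi]]]].
- by apply: Or31; apply: lateW d; lia.
- case: (leqP (k - 3) m) => mk.
    apply: Or31; apply: (@late_large m _ 3); first by lia.
    by move: le; case: (f _); clear -hk qe; lia.
  case: (leqP (pairs (kill (meet y))) m.+1) => pa.
    apply: Or32; exists m.+1; split=> //.
    by move: le; rewrite q_mulS; case: (f _); case: (kill _ _); clear -hk qe; lia.
  have pz := pairs_sub (@erode_copyb f).
  have cz := ndead_sub (@erode_copyb f).
  case: (copyb_count f) => [big|[p1 c1]].
    by exfalso; move: big pm mk; clear; lia.
  have km := kill_meet_count y.
  have py : pairs y = pairs (erode f) by rewrite pairs_iter_keep.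
  have ny : ndead y = ndead (erode f) by rewrite ndead_iter_keep.
  (* A gain of two takes one pair from the copy and one from the kill, which forces the block to
     start at cell [2]. *)
  have /andP[y2 y1] : y 2 && ~~ y 1.
    by move: km; case: (_ && _) => //; move: pa pz py p1 pm; clear; lia.
  have em : pairs y = m.+1 by move: km pa pz py p1 pm; rewrite y2 y1; clear; lia.
  have yi : sub y (iv 2 m.+2).
    rewrite -em; apply: block_from => //; first by clear -hk; lia.
    by move: cz c1 ny em pm; clear; lia.
  apply: Or33; exists k.-1, m.+3; split; try (by clear -hk mk; lia).
    have : m.+4 = k -> q * k = q * m + q + q + q + q by move=> <-; rewrite !q_mulS.
    by split; move: le; case: (f _); rewrite ?q_mulS; clear -hk qe mk; lia.
  by apply: kill_meet_iv2 => //; clear -mk; lia.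
have rot o1 n1 : o1 < k -> n1 < k -> sub (erode f) (iv o1 n1) ->
    sub y (iv (if o1.+1 == k then (if j == 0 then 0 else k - j)
               else if j <= o1.+1 then o1.+1 - j else o1.+1 + k - j) n1).
  move=> o1k n1k ei; rewrite /y iterD.
  have {}ei := iv_rot o1k n1k (leq_pred k) ei.
  have jk' : j <= k by clear -jk; lia.
  have e : (if k.-1 <= o1 then o1 - k.-1 else o1 + k - k.-1) = if o1.+1 == k then 0 else o1.+1.
    by case: eqP; case: leqP; clear -hk o1k; lia.
  rewrite e in ei.
  have lt : (if o1.+1 == k then 0 else o1.+1) < k by case: eqP; clear -hk o1k; lia.
  have := iv_rot lt n1k jk' ei.
  rewrite (_ : (if _ then _ else _) = if o1.+1 == k then (if j == 0 then 0 else k - j)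
     else if j <= o1.+1 then o1.+1 - j else o1.+1 + k - j) //.
  by case: (o1.+1 == k); case: (j) => //= *; rewrite ?subn0.
case: (o =P 1) => [o1|no].
  case: (n.+1 =P k) => [en|nn].
    apply: Or31; case: le => _ /(_ en) [_ le] _; move: le; rewrite /late.
    by clear -hk o1; lia.
  have ei : sub (erode f) (iv 0 n).
    by move=> i ik; clear le; rewrite (erodeE f ik); ivlia fi.
  have n_k : n < k by clear -nk; lia.
  have k0 : 0 < k by clear -hk; lia.
  have {}yi := rot _ _ k0 n_k ei.
  apply: Or32; exists n.-1; split.
    apply: kill_meet_iv yi => //; move: jk; clear -hk; do ?[case: ifP]; lia.
  have : n = n.-1.+1 by clear -nk; lia.
  case: le => a b c; case: (kill _ _) => /= => e; move: a b c; rewrite e q_mulS;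
    move: e; case: (n.-1) => [|n']; rewrite ?muln0; clear -hk nk nn o1 qe; lia.
(* [erode] removes one cell, but certified intervals are nonempty, so length [1] is kept. *)
have [n1 [n1k ei en]] : exists n1, [/\ 0 < n1 < k, sub (erode f) (iv o n1) &
    n = n1.+1 \/ (n = 1 /\ n1 = 1)].
  case: (n =P 1) => [e|ne].
    exists 1; split; [by clear -hk; lia| |by right].
    by move=> i ik; clear le; rewrite (erodeE f ik); ivlia fi.
  exists n.-1; split; try (by clear -ne nk; lia).
  by apply: erode_iv => //; [clear -ne nk; lia | apply/eqP].
have n1_k : n1 < k by clear -n1k; lia.
have := rot _ _ ok n1_k ei; set oy := (if _ then _ else _) => yi.
have oyk : oy < k by rewrite /oy; move: jk; clear -hk ok; do ?[case: ifP]; lia.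
case: (oy =P 2) => [ey|ny].
  have oj : o = j.+1.
    by move: ey; rewrite /oy; move: jk; clear -hk ok; do ?[case: ifP]; lia.
  rewrite ey in yi.
  case: (n1.+1 =P k) => [e|ne].
    exfalso; clear -hk e n1k en nk; lia.
  apply: Or33; exists k.-1, n1.+1; split; try (by clear -hk n1k ne; lia); last first.
    by apply: kill_meet_iv2.
  case: le => a b c; case: en => [e|[e e1]].
    by rewrite -e; split; clear -hk nk qe oj jk ne n1k e a b c; lia.
  by rewrite e1 /leA (mulnC q 2); split; clear -hk qe oj jk e a; lia.
apply: Or32; exists n1.-1; split; first exact: kill_meet_iv yi.
case: le => a b c; case: en => [e|[e e1]].
  have e2 : n1 = n1.-1.+1 by clear -n1k; lia.
  have e3 : n.+1 = k -> q * k = q * n1.-1 + q + q + q.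
    by rewrite e {1}e2 => <-; rewrite {1}e2 !q_mulS.
  have e4 : q * n = q * n1.-1 + q + q by rewrite e {1}e2 !q_mulS.
  by move: a b c; case: (kill _ _); clear -hk nk qe jk ok e n1k e3 e4 no; lia.
by rewrite e1 muln0; case: (kill _ _); move: jk; clear -hk; lia.
Qed.

(** * Words and the register *)

Fixpoint dead r : nat -> bool :=
  if r is l :: r' then
    push (dead r')
      [&& k <= size r, ~~ Defs.S k (rev (take k r)) || dead r' 0
        & ~~ Defs.S k (rev (take k.-1 r)) || dead r' 1]
  else fun=> false.

(* [cut r]: the end of [rev r] is reachable from one of its first [k] positions. *)
Inductive cut : word -> Prop :=
| cut_short r of size r < k : cut r
| cut_app s r of Defs.S k s & cut r : cut (rev s ++ r).

Lemma S_size s : Defs.S k s -> size s = k \/ size s = k.-1.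
Proof.
by case/orP => /andP[/andP[/eqP -> _] _]; [left | right].
Qed.

Lemma cut_inv r : k <= size r -> cut r ->
  (Defs.S k (rev (take k r)) /\ cut (drop k r)) \/
  (Defs.S k (rev (take k.-1 r)) /\ cut (drop k.-1 r)).
Proof.
move=> kr c; case: c kr => [r1 lt|s r1 Ss c1] kr; first by lia.
by have [e|e] := S_size Ss; [left | right];
  rewrite take_size_cat ?drop_size_cat ?size_rev // revK.
Qed.

Lemma cut_step r : k <= size r ->
  (Defs.S k (rev (take k r)) /\ cut (drop k r)) \/
  (Defs.S k (rev (take k.-1 r)) /\ cut (drop k.-1 r)) -> cut r.
Proof.
move=> kr [[Ss c]|[Ss c]].
  by rewrite -(cat_take_drop k r) -[take k r]revK; apply: cut_app.
by rewrite -(cat_take_drop k.-1 r) -[take k.-1 r]revK; apply: cut_app.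
Qed.

(** Cell [i] stands for the position [k - 1 - i] letters before the end; the size condition says
    that it exists. *)
Lemma deadP r i : i < k -> k.-1 <= i + size r ->
  dead r i = false <-> cut (drop (k.-1 - i) r).
Proof.
elim: r i => [|l r IH] i ik ir.
  by split=> // _; apply: cut_short; rewrite size_drop /=; lia.
rewrite [dead _]/= /push; case: eqP => [->|ne].
  rewrite subnn drop0; case: (leqP k (size (l :: r))) => kr /=; last first.
    by split=> // _; apply: cut_short.
  have e0 : drop k (l :: r) = drop (k.-1 - 0) r.
    by rewrite subn0; case: (k) hk.
  have e1 : drop k.-1 (l :: r) = drop (k.-1 - 1) r.
    have : 0 < k.-1 by lia.
    by rewrite subn1; case: (k.-1).
  have [k0 k1] : 0 < k /\ 1 < k by lia.
  have [s0 s1] : k.-1 <= 0 + size r /\ k.-1 <= 1 + size r by move: kr => /=; lia.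
  have I0 := IH 0 k0 s0; have I1 := IH 1 k1 s1.
  split=> [|/(cut_inv kr)]; last first.
    rewrite e0 e1 => -[[-> c]|[-> c]] /=; first by rewrite (proj2 I0 c).
    by rewrite (proj2 I1 c) andbF.
  case: (boolP (Defs.S k (rev (take k (l :: r))))) => [Sa|_] /=.
    case d0: (dead r 0) => /=; last first.
      by move=> _; apply: cut_step => //; left; split=> //; rewrite e0; apply/I0.
    case: (boolP (Defs.S k (rev (take k.-1 (l :: r))))) => [Sb|_] //= d1.
    by apply: cut_step => //; right; split=> //; rewrite e1; apply/I1.
  case: (boolP (Defs.S k (rev (take k.-1 (l :: r))))) => [Sb|_] //= d1.
  by apply: cut_step => //; right; split=> //; rewrite e1; apply/I1.
rewrite IH /=; [|by lia|by move: ir => /=; lia].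
by rewrite (_ : k.-1 - i = (k.-1 - i.+1).+1) //; lia.
Qed.

(* Every word shorter than [k] is a suffix and a prefix of an element of [S k], so
   both ends of a word impose no constraint. *)
Lemma S_prefix v : size v < k -> exists x, Defs.S k (x ++ v).
Proof.
move=> vk; exists (nseq (k - size v) La); apply/orP; left.
have -> : k - size v = (k - size v).-1.+1 by lia.
have k1 : 0 < k.-1 by lia.
rewrite size_cat size_nseq /=; apply/andP; split; last by case: (k.-1) k1.
by rewrite andbT; apply/eqP; lia.
Qed.

Lemma S_suffix v : size v < k -> exists y, Defs.S k (v ++ y).
Proof.
move=> vk; exists (nseq (k - size v) Lb); apply/orP; left.
have e : k - size v = (k - size v).-1.+1 by lia.
have h : rev (v ++ nseq (k - size v) Lb) = Lb :: rev (v ++ nseq (k - size v).-1 Lb).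
  by rewrite {1}e !rev_cat !rev_nseq.
rewrite size_cat size_nseq; apply/andP; split; last first.
  by apply: contra_eqN (h) => /eqP ->; rewrite rev_rcons.
apply/andP; split; first by apply/eqP; lia.
apply: contra_eqN (h) => /eqP ->; rewrite -cat1s rev_cat rev_nseq.
have : 0 < k.-1 by lia.
by case: (k.-1).
Qed.

Lemma cut_flatten r : cut r ->
  exists p ss, [/\ size p < k, all (Defs.S k) ss & rev r = p ++ flatten ss].
Proof.
elim=> [r1 lt|s r1 Ss _ [p [ss [pk al e]]]].
  by exists (rev r1), [::]; rewrite size_rev cats0.
exists p, (rcons ss s); rewrite all_rcons Ss; split=> //.
by rewrite rev_cat revK e flatten_rcons catA.
Qed.

Lemma cut_completable r j : j < k -> cut (drop j r) -> in_fact_star (Defs.S k) (rev r).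
Proof.
move=> jk /cut_flatten[p [ss [pk al e]]].
have [x Sx] := S_prefix pk.
have tk : size (rev (take j r)) < k.
  by rewrite size_rev size_take; case: ifP; lia.
have [y Sy] := S_suffix tk.
exists (x ++ rev r ++ y), x, y; split=> //.
exists ((x ++ p) :: rcons ss (rev (take j r) ++ y)); split.
  by rewrite /= Sx all_rcons Sy.
rewrite /= flatten_rcons -{2}(cat_take_drop j r) rev_cat e.
by rewrite -!catA.
Qed.

Lemma flatten_split ss p v : all (Defs.S k) ss -> flatten ss = p ++ v ->
  exists p' ss', [/\ size p' < k, all (Defs.S k) ss' & v = p' ++ flatten ss'].
Proof.
elim: ss p => [|s ss IH] p /=.
  by case: p => //= _ <-; exists [::], [::]; split=> //; exact: ltn_trans hk.
case/andP=> Ss al e; case: (leqP (size s) (size p)) => sp.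
  apply: (IH (drop (size s) p) al).
  have := congr1 (drop (size s)) e; rewrite drop_size_cat // drop_cat.
  case: ltnP => // ps.
  have -> : size p = size s by lia.
  by rewrite subnn drop0 drop_oversize //; lia.
have ev : v = drop (size p) s ++ flatten ss.
  by have := congr1 (drop (size p)) e; rewrite drop_cat sp drop_size_cat.
have [e'|e'] := S_size Ss; last first.
  by exists (drop (size p) s), ss; split=> //; rewrite size_drop e'; lia.
case: (posnP (size p)) => p0.
  exists [::], (s :: ss); rewrite /= Ss al; split=> //; first by lia.
  by rewrite ev p0 drop0.
by exists (drop (size p) s), ss; split=> //; rewrite size_drop; lia.
Qed.

(** Factors are consumed until the next one would pass the end of [w]; fewer than [k] letters of [w]
    are then left. *)
Lemma cut_within ss r v w : cut r -> all (Defs.S k) ss -> size r <= size w ->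
  rev r ++ flatten ss = w ++ v -> exists2 j, j < k & cut (drop j (rev w)).
Proof.
elim: ss r => [|s ss IH] r cr /=.
  move=> _ rw; rewrite cats0 => e; exists 0; first by lia.
  rewrite drop0 (_ : rev w = r) //.
  have := congr1 (take (size w)) e; rewrite take_size_cat // take_oversize ?size_rev //.
  by move=> <-; rewrite revK.
case/andP=> Ss al rw e; case: (leqP (size (rev s ++ r)) (size w)) => sw.
  by apply: (IH (rev s ++ r)) => //; [exact: cut_app | rewrite rev_cat revK -catA].
exists (size w - size r).
  by move: sw; rewrite size_cat size_rev; case: (S_size Ss) => ->; lia.
have := congr1 (take (size r)) e; rewrite take_size_cat ?size_rev // take_cat.
have er : rev w = rev (drop (size r) w) ++ rev (take (size r) w).
  by rewrite -rev_cat cat_take_drop.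
have d : size (rev (drop (size r) w)) = size w - size r by rewrite size_rev size_drop.
rewrite er -d drop_size_cat //.
case: ltnP => [_ <-|wr e2]; first by rewrite revK.
have ewr : size r = size w by lia.
by move: e2; rewrite ewr subnn take0 cats0 take_size => <-; rewrite revK.
Qed.

Lemma completable_cut w : k <= size w -> in_fact_star (Defs.S k) w ->
  exists2 j, j < k & cut (drop j (rev w)).
Proof.
move=> kw [u [p [v [[ss [al eu]] e]]]]; rewrite -{}eu in e.
have [p' [ss' [pk al' e']]] := flatten_split al e.
apply: (@cut_within ss' (rev p') v) => //.
- by apply: cut_short; rewrite size_rev.
- by rewrite size_rev; lia.
by rewrite revK.
Qed.

Lemma uncompletable_dead w : uncompletable k w -> forall i, i < k -> dead (rev w) i.
Proof.
move=> un; have nc j : j < k -> ~ cut (drop j (rev w)).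
  by move=> jk /(cut_completable jk); rewrite revK.
have kw : k <= size w.
  rewrite leqNgt; apply/negP => wk; apply: (nc 0); first by lia.
  by apply: cut_short; rewrite drop0 size_rev.
move=> i ik; case d: (dead _ i) => //.
by case: (@nc (k.-1 - i)); [lia | apply/deadP => //; rewrite size_rev; lia].
Qed.

Lemma dead_uncompletable w : k <= size w -> (forall i, i < k -> dead (rev w) i) ->
  uncompletable k w.
Proof.
move=> kw d /(completable_cut kw)[j jk c].
have := @deadP (rev w) (k.-1 - j); rewrite subKn; last by lia.
rewrite d; last by lia.
have jk' : k.-1 - j < k by lia.
have js : k.-1 <= k.-1 - j + size (rev w) by rewrite size_rev; lia.
by move=> /(_ jk' js) [_ /(_ c)].
Qed.

(** * The transition rule of the register *)

Lemma notS_long v : size v = k -> ~~ Defs.S k (rev v) =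
  (v == rcons (nseq k.-1 La) Lb) || (v == La :: nseq k.-1 Lb).
Proof.
move=> e; rewrite /Defs.S size_rev e eqxx (_ : k == k.-1 = false) /=; last by lia.
rewrite orbF negb_and !negbK; congr (_ || _).
  by rewrite -(inj_eq (can_inj (@revK letter))) revK rev_cons rev_nseq.
by rewrite -(inj_eq (can_inj (@revK letter))) revK rev_rcons rev_nseq.
Qed.

Lemma notS_short v : size v = k.-1 -> ~~ Defs.S k (rev v) =
  (v == nseq k.-1 La) || (v == nseq k.-1 Lb).
Proof.
move=> e; rewrite /Defs.S size_rev e eqxx (_ : k.-1 == k = false) /=; last by lia.
by rewrite negb_and !negbK -!(inj_eq (can_inj (@revK letter)) (rev v)) revK !rev_nseq.
Qed.

(** The suffix [a^(k-1)] forbids the short step, which gives [keep]; [b^(k-1) a] forbids the long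
    one, which gives [copy]; [b a^(k-1)] forbids both, which gives [kill]. *)
Lemma dead_consA r : k.-1 <= size r -> dead (La :: r) =
  (if (lead La r).+1 == k.-1 then kill else if k.-1 <= lead La r then keep
   else if k.-1 <= lead Lb r then copy else meet) (dead r).
Proof.
move=> kr; have kr' : k <= size (La :: r) by rewrite /=; lia.
rewrite [dead _]/= notS_long ?notS_short; try by rewrite size_take; case: ltnP; lia.
rewrite -[in take k _](prednK (n := k)); last by lia.
rewrite take_lead_end //.
rewrite !take_lead /= eqseq_cons eqxx take_lead lead_same lead_other //.
rewrite (_ : (k <= (size r).+1)); last by lia.
have last_b : (lead La r).+1 == k.-1 -> nth La (La :: r) k.-1 == Lb.
  move/eqP=> e; rewrite -e /=.
  have lt : lead La r < size r by clear -e kr; lia.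
  have : has (predC1 La) r by rewrite has_find.
  by move/(nth_find La); rewrite -/(lead La r) /=; case: (nth _ _ _).
have leadb : 0 < lead Lb r -> lead La r = 0 by case: (r) => [|[] r'].
rewrite (_ : (k.-1 <= 0) = false) /= ?orbF; last by lia.
case: eqP last_b => [e /(_ isT) -> | ne _] /=; first by rewrite e leqnn.
have -> : (k.-1 <= (lead La r).+1) = (k.-1 <= lead La r) by lia.
case: (leqP k.-1 (lead La r)) => [a|a] /=.
  rewrite ?andbT (_ : (k.-1 <= lead Lb r) = false) //.
  by apply/negbTE/negP => b; move: leadb; clear -hk a b; lia.
by case: (leqP k.-1 (lead Lb r)).
Qed.

Lemma dead_consB r : k.-1 <= size r -> dead (Lb :: r) =
  (if k.-1 <= (lead Lb r).+1 then keep else meet) (dead r).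
Proof.
move=> kr; have kr' : k <= size (Lb :: r) by rewrite /=; lia.
rewrite [dead _]/= notS_long ?notS_short; try by rewrite size_take; case: ltnP; lia.
have -> : (take k (Lb :: r) == rcons (nseq k.-1 La) Lb) = false.
  by case: (k) hk => [|[|k']].
have -> : (take k (Lb :: r) == La :: nseq k.-1 Lb) = false by case: (k) hk.
rewrite !take_lead lead_same lead_other //.
rewrite (_ : (k.-1 <= 0) = false) /=; last by lia.
rewrite kr' /=.
by case: leqP; rewrite ?andbT.
Qed.

(** A conjunction cannot complete the register, since a dead result requires the overwritten cell to
    be dead. *)
Lemma full_meet n g : (forall i, i < k -> iter n meet g i) -> forall i, i < k -> g i.
Proof.
elim: n => // n IH al; apply: IH => i ik; case: (posnP i) => [->|i0].
  by have := al k.-1; rewrite iterS /meet /push eqxx => /(_ ltac:(lia))/andP[].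
have := al i.-1; rewrite iterS /meet /push ifF; last by lia.
by rewrite prednK //; apply; lia.
Qed.

Lemma sub_iter_iter n m f : sub (iter (n + m) meet f) (iter n keep (iter m meet f)).
Proof. by rewrite iterD; apply: sub_iter_meet_keep => //; apply: sub_refl. Qed.

Lemma keep_certA_iter n t f : certA t f -> certA (t + n) (iter n keep f).
Proof. by move=> c; elim: n => [|n IH]; rewrite ?addn0 ?addnS //=; apply: keep_certA. Qed.

Lemma keep_certB_iter n t f : certB t f -> certB (t + n) (iter n keep f).
Proof. by move=> c; elim: n => [|n IH]; rewrite ?addn0 ?addnS //=; apply: keep_certB. Qed.

(** * The lower bound *)

(* [na] and [nb] are the lengths of the current run of [a]s or [b]s (one of them
   is [0]), and [LongX_y] means that the last long run consists of [X]s and the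
   current, still short, run of [y]s.  The register is only bounded from above;
   earlier short runs are partly relaxed from [meet] to [keep]. *)
Inductive phase (na nb t : nat) f : Prop :=
| Fresh of (forall i, i < k -> ~~ f i)
| LongA of k.-1 <= na & certA t f
| LongA_b g t0 of 0 < nb < k.-1 & certA t0 g & t = t0 + nb & sub f (iter nb meet g)
| LongA_a g t0 of na < k.-1 & nb = 0 & certA t0 g & t = t0 + na.+1
    & sub f (iter na.+1 meet g)
| LongB of k.-1 <= nb & certB t f
| LongB_a g t0 of 0 < na < k.-1 & certB t0 g & t = t0 + na
    & sub f (iter na.-1 meet (copy g))
| LongB_ab g t0 i of 0 < nb < k.-1 & certB t0 g & t = t0 + 1 + i + nb
    & sub f (iter (i + nb) meet (copy g))
| LongB_aa g t0 i of na < k.-1 & nb = 0 & i + 3 <= k & certB t0 g & t = t0 + 2 + i + na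
    & sub f (iter (i + 1 + na) meet (copy g)).

Lemma phase_final na nb t f : phase na nb t f -> (forall i, i < k -> f i) -> late t.
Proof.
have fullB n g t0 : certB t0 g -> t0 < t -> (forall i, i < k -> f i) ->
    sub f (iter n meet (copy g)) -> late t.
  move=> c lt al s; apply: (@lateW t0.+1) => //; apply: (certB_copy_full c).
  by apply: (@full_meet n) => i ik; apply: s (al i ik).
have fullA n g t0 : certA t0 g -> t0 <= t -> (forall i, i < k -> f i) ->
    sub f (iter n meet g) -> late t.
  move=> c lt al s; apply: (@lateW t0) => //; apply: (certA_full c).
  by apply: (@full_meet n) => i ik; apply: s (al i ik).
case=> [z|_ c|g t0 _ c e s|g t0 _ _ c e s|_ c|g t0 na0 c e s|g t0 i _ c e s|g t0 i _ _ _ c e s] al.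
- by have := z 0; rewrite al //; [move/(_ ltac:(lia))|lia].
- exact: certA_full c al.
- by apply: fullA c _ al s; lia.
- by apply: fullA c _ al s; lia.
- exact: certB_full c al.
- by apply: (fullB _ g t0 c _ al s); lia.
- by apply: (fullB _ g t0 c _ al s); lia.
by apply: (fullB _ g t0 c _ al s); lia.
Qed.

Lemma sub_meetS n f g : sub f (iter n meet g) -> sub (meet f) (iter n.+1 meet g).
Proof. by rewrite iterS; apply: sub_meet. Qed.

Lemma meet_keepS n g : sub (iter n.+1 meet g) (meet (iter n keep g)).
Proof.
by rewrite iterS; apply: sub_meet; apply: sub_iter_meet_keep => //; apply: sub_refl.
Qed.

(** For [i = 0] the outer [meet] repeats the last conjunction of [erode], whose value already
    includes both operands. For larger [i], [k] of the rotations cancel. *)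
Lemma meet_eroded i g :
  sub (iter (i + k.-1) meet (copy g)) (meet (iter (i + k.-1) keep (erode g))).
Proof.
rewrite iterD -/(erode g); case: i => [|i].
  move=> i ik; rewrite /= ?add0n /meet /push.
  have k1 : k.-1 <= k by lia.
  have kl : k.-1 < k by lia.
  have k0 : 0 < k by lia.
  have kk : 1 < k by lia.
  case: eqP => [->|ne].
    rewrite !iter_keepE // add0n kl ifF; last by lia.
    rewrite (_ : 1 + k.-1 - k = 0); last by lia.
    rewrite !erodeE //= eqxx (_ : (k.-1 == 0) = false); last by lia.
    by case/andP=> -> ->.
  rewrite iter_keepE //; last by lia.
  by rewrite ifF; [rewrite (_ : _ - k = i) //; lia | lia].
rewrite iterS; apply: sub_meet => //; apply: sub_trans (@sub_iter_meet_keep i _ _ (@sub_refl _)) _.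
rewrite addSnnS iterD prednK; last by lia.
apply: sub_iter_keep => // j jk; rewrite iter_keepE // ifF; last by lia.
by rewrite addnK.
Qed.

Lemma fresh_meet f : (forall i, i < k -> ~~ f i) -> forall x i, i < k -> x = false ->
  ~~ push f x i.
Proof. by move=> z x i ik ->; rewrite /push; case: eqP => // ne; apply: z; lia. Qed.

Lemma phase_a na nb t f : k.-1 <= t -> na = 0 \/ nb = 0 -> phase na nb t f ->
  phase na.+1 0 t.+1
    ((if na.+1 == k.-1 then kill else if k.-1 <= na then keep
      else if k.-1 <= nb then copy else meet) f).
Proof.
move=> kt n0.
case=> [z|na1 c|g t0 nb1 c e s|g t0 na1 nb0 c e s|nb1 c|g t0 na1 c e s|g t0 i nb1 c e s
       |g t0 i na1 nb0 ik c e s].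
- case: eqP => [e|_].
    apply: LongA; first by lia.
    (* The first kill: [kt] is what [leA] requires for one cell at [k - 1]. *)
    apply: Or33; exists k.-1, 1; split; try lia; first by split; lia.
    move=> i ik; rewrite /kill /push /iv; case: eqP => [->|ne]; first by lia.
    by move=> fi; case/negP: (z i.+1 ltac:(lia)).
  apply: Fresh => i ik.
  have z0 : f 0 = false by apply: negbTE; apply: z; lia.
  have z1 : f 1 = false by apply: negbTE; apply: z; lia.
  by do ?[case: ifP => _]; apply: fresh_meet; rewrite ?z0.
- rewrite ifF; last by lia.
  by rewrite na1; apply: LongA; [lia | apply: keep_certA].
- have na0 : na = 0 by lia.
  subst na; rewrite ifF; last by lia.
  rewrite ifF; last by lia.
  rewrite ifF; last by lia.
  (* Only the last [b] and the new [a] stay conjunctions, which is the start of a possible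
     [rekill]. *)
  apply: (@LongA_a _ _ _ _ (iter nb.-1 keep g) (t0 + nb.-1)) => //; try lia.
    exact: keep_certA_iter.
  apply: (@sub_meetS 1); apply: sub_trans s _; case: nb nb1 {n0 e} => [|nb] nb1; first by [].
  exact: (@meet_keepS nb g).
- case: eqP => [en|ne].
    apply: LongA; first by lia.
    rewrite (_ : t.+1 = t0 + k); last by lia.
    by apply: certA_sub (rekill_cert c) => //; rewrite /rekill -en; apply: sub_kill.
  rewrite ifF; last by lia.
  rewrite ifF; last by lia.
  by apply: (@LongA_a _ _ _ _ g t0) => //; try lia; apply: sub_meetS.
- have na0 : na = 0 by lia.
  subst na; rewrite ifF; last by lia.
  rewrite ifF; last by lia.
  by rewrite nb1; apply: (@LongB_a _ _ _ _ f t) => //; lia.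
- case: eqP => [en|ne].
    apply: LongA; first by lia.
    rewrite (_ : t.+1 = t0 + k.-1); last by lia.
    apply: certA_sub (runa_cert c) => //.
    by rewrite /runa (_ : k - 3 = na.-1); [apply: sub_kill | lia].
  rewrite ifF; last by lia.
  rewrite ifF; last by lia.
  apply: (@LongB_a _ _ _ _ g t0) => //; try lia.
  by case: na na1 s {n0 ne e} => // na _ s; apply: sub_meetS.
- have na0 : na = 0 by lia.
  subst na; rewrite ifF; last by lia.
  rewrite ifF; last by lia.
  rewrite ifF; last by lia.
  have e2 : i + nb = (i + nb).-1.+1 by lia.
  have s2 : sub (meet f) (iter 2 meet (iter (i + nb).-1 meet (copy g))).
    by apply: (@sub_meetS 1); apply: sub_trans s _; rewrite {1}e2; apply: sub_refl.
  case: (leqP ((i + nb).-1 + 3) k) => h.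
    apply: (@LongB_aa _ _ _ _ g t0 (i + nb).-1) => //; try lia.
    by rewrite (_ : (i + nb).-1 + 1 + _ = 2 + (i + nb).-1) ?iterD //; lia.
  (* With [i + nb >= k - 1], the copy and the first [k - 2] conjunctions are dominated by [runa], as
     if a long run of [a]s had been read. The rest is relaxed except for the last two letters. *)
  apply: (@LongA_a _ _ _ _ (iter ((i + nb).-1 - k.-2) keep (runa g))
    (t0 + k.-1 + ((i + nb).-1 - k.-2))) => //; try lia.
    by apply: keep_certA_iter; apply: runa_cert.
  apply: sub_trans s2 _; apply: (@sub_iter_meet 2).
  rewrite -{1}(subnK (_ : k.-2 <= (i + nb).-1)); last by lia.
  apply: sub_trans (@sub_iter_iter _ _ _) _; apply: sub_iter_keep => //.
  rewrite (_ : k.-2 = (k - 3).+1); last by lia.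
  by apply: sub_meet_kill => //; apply: sub_refl.
case: eqP => [en|ne].
  apply: LongA; first by lia.
  rewrite (_ : t.+1 = t0 + k + 1 + i); last by lia.
  apply: certA_sub (copya_cert ik c) => //; apply: sub_kill => //.
  apply: sub_trans s _; rewrite (_ : i + 1 + na = i + k.-1); last by lia.
  exact: meet_eroded.
rewrite ifF; last by lia.
rewrite ifF; last by lia.
apply: (@LongB_aa _ _ _ _ g t0 i) => //; try lia.
by rewrite addnS; apply: sub_meetS.
Qed.

Lemma phase_b na nb t f : na = 0 \/ nb = 0 -> phase na nb t f ->
  phase 0 nb.+1 t.+1 ((if k.-1 <= nb.+1 then keep else meet) f).
Proof.
move=> n0.
case=> [z|na1 c|g t0 nb1 c e s|g t0 na1 nb0 c e s|nb1 c|g t0 na1 c e s|g t0 i nb1 c e s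
       |g t0 i na1 nb0 ik c e s].
- apply: Fresh => i ik.
  have z0 : f 0 = false by apply: negbTE; apply: z; lia.
  by case: ifP => _; apply: fresh_meet => //; rewrite z0.
- have nb0 : nb = 0 by lia.
  subst nb; rewrite ifF; last by lia.
  by apply: (@LongA_b _ _ _ _ f t) => //; lia.
- case: leqP => h.
    apply: LongB; first by lia.
    rewrite (_ : t.+1 = t0 + k.-1); last by lia.
    apply: certB_sub (runb_cert c) => //.
    by rewrite /runb (_ : k.-2 = nb); [apply: sub_keep | lia].
  by apply: (@LongA_b _ _ _ _ g t0) => //; try lia; apply: sub_meetS.
- rewrite ifF; last by lia.
  apply: (@LongA_b _ _ _ _ (iter na.+1 keep g) (t0 + na.+1)) => //; try lia.
    exact: keep_certA_iter.
  rewrite nb0; apply: sub_meet; apply: sub_trans s _.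
  by apply: sub_iter_meet_keep => //; apply: sub_refl.
- rewrite ifT; last by lia.
  by apply: LongB; [lia | apply: keep_certB].
- rewrite ifF; last by lia.
  apply: (@LongB_ab _ _ _ _ g t0 na.-1) => //; try lia.
  by rewrite (_ : nb = 0) ?addn1; [exact: sub_meetS | lia].
- case: leqP => h.
    apply: LongB; first by lia.
    rewrite (_ : t.+1 = t0 + k + i); last by lia.
    apply: certB_sub (keep_certB_iter i (copyb_cert c)) => //.
    (* The first [nb] conjunctions serve for [copyb], whichever letters caused them; the last [i]
       become rotations. *)
    rewrite /copyb -iterSr iterS; apply: sub_keep => //; apply: sub_trans s _.
    by rewrite (_ : nb = k.-2); [exact: sub_iter_iter | lia].
  apply: (@LongB_ab _ _ _ _ g t0 i) => //; try lia.
  by rewrite addnS; apply: sub_meetS.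
rewrite ifF; last by lia.
apply: (@LongB_ab _ _ _ _ g t0 (i + 1 + na)) => //; try lia.
by rewrite nb0 addn1; apply: sub_meetS.
Qed.

Lemma dead_short r i : size r < k -> i < k -> ~~ dead r i.
Proof.
elim: r i => // l r IH i sr ik; rewrite [dead _]/= /push leqNgt sr /=.
by case: eqP => // ne; apply: IH; rewrite /= in sr; lia.
Qed.

Lemma dead_phase r : phase (lead La r) (lead Lb r) (size r) (dead r).
Proof.
elim: r => [|l r IH]; first by apply: Fresh.
case: (leqP k (size (l :: r))) => kr; last by apply: Fresh => i; apply: dead_short.
have kr' : k.-1 <= size r by rewrite /= in kr; lia.
case: l kr => kr; rewrite lead_same lead_other //.
  by rewrite dead_consA //; exact: (phase_a kr' (lead_ab r) IH).
by rewrite dead_consB //; exact: (phase_b (lead_ab r) IH).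
Qed.

Lemma uncompletable_size w : uncompletable k w -> late (size w).
Proof.
move=> /uncompletable_dead al; rewrite -(size_rev w).
exact: phase_final (dead_phase (rev w)) al.
Qed.

Arguments dead : simpl never.

(** * An uncompletable word of minimal length *)

Lemma read_b n r : k.-1 <= size r -> lead Lb r = 0 -> n <= k.-2 ->
  dead (nseq n Lb ++ r) = iter n meet (dead r).
Proof.
move=> kr r0; elim: n => // n IH nk; rewrite /= dead_consB //; last first.
  by rewrite size_cat; lia.
by rewrite lead_nseq r0 IH ?ifF //; lia.
Qed.

Lemma read_runb n r : k.-1 <= size r -> lead Lb r = 0 ->
  dead (nseq (k.-1 + n) Lb ++ r) = iter n keep (runb (dead r)).
Proof.
move=> kr r0; rewrite addnC; elim: n => [|n IH].
  rewrite add0n (_ : k.-1 = k.-2.+1); last by lia.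
  rewrite /= dead_consB //; last by rewrite size_cat; lia.
  by rewrite lead_nseq r0 read_b // ifT //; lia.
rewrite addSn /= dead_consB //; last by rewrite size_cat; lia.
by rewrite lead_nseq IH ifT //; lia.
Qed.

Lemma read_a n r : k.-1 <= size r -> k.-1 <= lead Lb r -> n <= k - 3 ->
  dead (nseq n.+1 La ++ r) = iter n meet (copy (dead r)).
Proof.
move=> kr rb; have ra : lead La r = 0 by case: (lead_ab r) => //; lia.
elim: n => [|n IH] nk.
  rewrite /= dead_consA // ra ifF; last by lia.
  by rewrite ifF ?rb //; lia.
rewrite cat_nseqS dead_consA //; last by rewrite size_cat; lia.
rewrite lead_nseq ra lead_nseq_other // ifF; last by lia.
by rewrite ifF ?ifF ?IH //; lia.
Qed.

Lemma read_runa n r : k.-1 <= size r -> k.-1 <= lead Lb r ->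
  dead (nseq (k.-1 + n) La ++ r) = iter n keep (runa (dead r)).
Proof.
move=> kr rb; have ra : lead La r = 0 by case: (lead_ab r) => //; lia.
rewrite addnC; elim: n => [|n IH].
  rewrite add0n (_ : k.-1 = (k - 3).+2); last by lia.
  rewrite cat_nseqS dead_consA //; last first.
    by rewrite size_cat; lia.
  by rewrite lead_nseq ra read_a // ifT //; lia.
rewrite addSn cat_nseqS dead_consA //; last first.
  by rewrite size_cat; lia.
rewrite lead_nseq ra IH ifF; last by lia.
by rewrite ifT //; lia.
Qed.

(* As words are reversed, the rounds are written from right to left. *)
Definition next_round i r :=
  nseq (k.-1 + 1) La ++ nseq (k.-1 + (k.-2 - i)) Lb ++ nseq (k.-1 + i.+1) La
    ++ nseq (k.-1 + 0) Lb ++ r.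

Fixpoint rounds n := if n is n'.+1 then next_round n (rounds n')
  else nseq (k.-1 + 1) La ++ [:: Lb].

(** An isolated cell [k - 2], the gap [k - 1] and a block of [i] cells at [0]. For [i = 1] only the
    cell of the first kill is required. *)
Definition ready i f := f k.-2 /\ (1 < i -> forall j, j < i -> f j).

Lemma next_round_ready i r : 0 < i -> i + 3 <= k -> k.-1 <= lead La r -> k.-1 <= size r ->
  ready i (dead r) -> ready i.+1 (dead (next_round i r)).
Proof.
move=> i0 ik ra kr [fk fi]; have rb : lead Lb r = 0 by case: (lead_ab r) => //; lia.
have s0 n : k.-1 <= n + size r by lia.
rewrite /next_round read_runa; first last.
- by rewrite lead_nseq; lia.
- by rewrite !size_cat !size_nseq; lia.
rewrite read_runb; first last.
- by rewrite lead_nseq_other //; lia.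
- by rewrite !size_cat !size_nseq; lia.
rewrite read_runa; first last.
- by rewrite lead_nseq; lia.
- by rewrite !size_cat !size_nseq; lia.
rewrite read_runb //.
set g1 := iter 0 _ _; set g2 := iter i.+1 _ _; set g3 := iter (k.-2 - i) _ _.
(* The first run puts the gap at cell [0]; the second fills it by a copy, giving [i + 1] consecutive
   cells that end at [k - 2]; the third shifts them without loss to start at [1]; the fourth keeps
   them by a copy and kills a new isolated cell. *)
have h1 j : j < k -> (0 < j < i) || (j == k.-1) -> g1 j.
  move=> jk hj; rewrite /g1 /= runbE //; case: eqP => [e|j0]; first by lia.
  by case: eqP => [//|j1]; rewrite !fi //; lia.
have h2 j : j < k -> k.-2 - i <= j <= k.-2 -> g2 j.
  move=> jk hj; rewrite /g2 iter_keepE //; last by lia.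
  rewrite runaE //; last by case: ifP; lia.
  case: eqP => [e|e0]; first by apply: h1; lia.
  case: eqP => [//|e1].
  case: eqP => [e|e2]; first by apply: h1; move: e; case: ifP; lia.
  by apply/andP; split; apply: h1; move: e0 e1 e2; case: ifP; lia.
have h3 j : j < k -> 1 <= j <= i.+1 -> g3 j.
  move=> jk hj; rewrite /g3 iter_keepE //; last by lia.
  rewrite runbE //; last by case: ifP; lia.
  case: eqP => [e|e0]; first by move: e; case: ifP; lia.
  case: eqP => [e|e1]; first by apply: h2; lia.
  by apply/andP; split; apply: h2; move: e0 e1; case: ifP; lia.
have h4 j : j < k -> (j == k.-2) || (j <= i) -> iter 1 keep (runa g3) j.
  move=> jk hj; rewrite iter_keepE //; last by lia.
  rewrite runaE //; last by case: ifP; lia.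
  case: eqP => [e|e0]; first by move: e; case: ifP; lia.
  case: eqP => [//|e1].
  case: eqP => [e|e2]; first by apply: h3; lia.
  by apply/andP; split; apply: h3; move: e0 e1 e2; case: ifP; lia.
by split=> [|_ j ji]; apply: h4; lia.
Qed.

Lemma rounds_ready n : n + 3 <= k ->
  [/\ ready n.+1 (dead (rounds n)), k.-1 <= lead La (rounds n)
    & size (rounds n) = k + 1 + n * (5 * k - 4)].
Proof.
elim: n => [|n IH] nk.
  split; [|by rewrite /= lead_nseq; lia|by rewrite size_cat size_nseq /=; lia].
  split=> //; rewrite [rounds 0]/= addn1 cat_nseqS.
  rewrite dead_consA //; last by rewrite size_cat size_nseq /=; lia.
  rewrite lead_nseq lead_other // ifF; last by lia.
  rewrite ifT /keep /push; last by lia.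
  rewrite ifF; last by lia.
  have e : k.-1 = k.-2.+1 by lia.
  rewrite [in nseq _ _]e cat_nseqS.
  rewrite dead_consA //; last by rewrite size_cat size_nseq /=; lia.
  rewrite lead_nseq lead_other // ifT; last by lia.
  by rewrite /kill /push -e eqxx.
have [|rd la sz] := IH; first by lia.
have szk : k.-1 <= size (rounds n) by rewrite sz; move: (n * _) => x; lia.
split; first by apply: next_round_ready.
  by rewrite /= /next_round lead_nseq; lia.
rewrite -[rounds n.+1]/(next_round n.+1 (rounds n)) /next_round.
rewrite !size_cat !size_nseq sz (mulSn n).
by move: (n * (5 * k - 4)) => x; lia.
Qed.

Lemma witness : exists w, uncompletable k w /\ size w = 5 * k ^ 2 + 13 - 17 * k.
Proof.
have [|[rk ri] ra sz] := @rounds_ready (k - 3); first by lia.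
have rb : lead Lb (rounds (k - 3)) = 0 by case: (lead_ab (rounds (k - 3))) => //; lia.
set r := rounds _ in rk ri ra sz rb.
have kr : k.-1 <= size r by rewrite sz; move: (_ * _) => x; lia.
set v := La :: nseq (k.-1 + 0) Lb ++ r.
have sv : size v = k + size r by rewrite /= size_cat size_nseq; lia.
exists (rev v); rewrite size_rev; split.
  apply: dead_uncompletable; first by rewrite size_rev sv; lia.
  rewrite revK /v => i ik; rewrite dead_consA //; last by rewrite size_cat; lia.
  rewrite lead_nseq lead_nseq_other //; last by lia.
  rewrite ifF; last by lia.
  rewrite ifF; last by lia.
  rewrite ifT; last by lia.
  rewrite read_runb //.
  (* Only cell [k - 1] may still be alive; [runb] brings it to cell [0], where the final copy
     overwrites it. *)
  have d j : j < k.-1 -> dead r j.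
    by move=> jk; case: (j =P k.-2) => [->|ne] //; apply: ri; lia.
  have h j : j < k -> 0 < j -> runb (dead r) j.
    move=> jk j0; rewrite runbE //; case: eqP; first by lia.
    by case: eqP => [//|j1 _]; rewrite !d //; lia.
  by rewrite /copy /push; case: eqP => ?; apply: h; lia.
rewrite sv sz expnS expn1; have [d ->] : exists d, k = d + 4 by exists (k - 4); lia.
have -> : d + 4 - 3 = d + 1 by lia.
have -> : 5 * (d + 4) - 4 = 5 * d + 16 by lia.
by nia.
Qed.

End Register.

Theorem theorem4 (k : nat) (hk : 4 <= k) :
  (forall w : word, uncompletable k w -> 5 * k ^ 2 + 13 - 17 * k <= size w) /\
  (exists w : word, uncompletable k w /\ size w = 5 * k ^ 2 + 13 - 17 * k).
Proof.
split; last exact: witness.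
move=> w /(uncompletable_size hk); rewrite /late /q expnS expn1.
(* This lets the truncated subtraction in [q] be evaluated before [nia]. *)
have [d ->] : exists d, k = d + 4 by exists (k - 4); lia.
have -> : 5 * (d + 4) - 4 = 5 * d + 16 by lia.
by nia.
Qed.
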